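(* There exist absolute constants $c,C>0$ such that the following holds. Let $A\in\mathbb{R}^{m\times n}$, let $1\le k\le l\le l'$ with $l\le n$, $l'\le m$, let $0<\epsilon<1/6$ and $\delta>2e^{-k/5}$. Let $U_1\in\mathbb{R}^{l'\times m}$ be drawn from a distribution that is an $(l,\epsilon,\delta)$ oblivious subspace embedding from $\mathbb{R}^m$ into $\mathbb{R}^{l'}$, and let $V_1\in\mathbb{R}^{n\times l}$, independent of $U_1$, be such that $V_1^T$ is drawn from a distribution that is a $(k,\epsilon,\delta)$ oblivious subspace embedding from $\mathbb{R}^n$ into $\mathbb{R}^l$. Let $A_k$ be the generalized LU (GLU) approximation of $A$ determined by $U_1,V_1$ (see context). (i) With probability at least $1-2\delta$, for $1\le j\le k$, $$\sigma_j(A_k)\ \ge\ c\sqrt{\frac{k}{n}}\;\sigma_j(A).$$ (ii) For any fixed $1\le j\le \min(m,n)-k$, with probability at least $1-4\delta$, $$\sigma_j(A-A_k)\ \le\ C\sqrt{\frac{mn}{kl}}\;\sigma_{k+j}(A).$$ (iii) If additionally $U_1$ is drawn from a $(\sqrt{\epsilon/l},\delta,m)$ Johnson–Lindenstrauss transform and $V_1^T$ is drawn from a $(\sqrt{\epsilon/k},\delta,n)$ Johnson–Lindenstrauss transform, then with probability at least $1-4\delta$, $$\|A-A_k\|_F^2\ \le\ (1+C\epsilon)\,\|A-A_{\mathrm{opt},k}\|_F^2 .$$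
   Context: Singular values $\sigma_1\ge\sigma_2\ge\cdots$ are in decreasing order; $X^+$ is the Moore–Penrose pseudo-inverse; $A_{\mathrm{opt},k}$ is the rank-$k$ truncated SVD of $A$. An $(\epsilon,\delta,N)$ Johnson–Lindenstrauss transform (JLT) from $\mathbb{R}^n$ to $\mathbb{R}^s$ is a distribution over $s\times n$ matrices $U$ such that for every fixed set $T\subset\mathbb{R}^n$ of $N$ unit vectors, with probability at least $1-\delta$, $1-\epsilon\le\|Ux\|_2^2\le 1+\epsilon$ for all $x\in T$. A $(k,\epsilon,\delta)$ oblivious subspace embedding (OSE) from $\mathbb{R}^n$ to $\mathbb{R}^s$ (with $s\ge k$) is a distribution over $s\times n$ matrices $U$ such that for every fixed $n\times k$ matrix $Q$ with orthonormal columns, with probability at least $1-\delta$, $1-\epsilon\le\sigma_{\min}(UQ)\le\sigma_{\max}(UQ)\le1+\epsilon$. GLU approximation: given $U_1\in\mathbb{R}^{l'\times m}$ of full row rank and $V_1\in\mathbb{R}^{n\times l}$ of full column rank, $$A_k:=\Big[U_1^+\big(I-(U_1AV_1)(U_1AV_1)^+\big)+(AV_1)(U_1AV_1)^+\Big]\,U_1A .$$ Standing assumption: (almost surely) $U_1$ and $V_1$ have full rank and the $l'\times l$ matrix $U_1AV_1$ has full column rank. Note that $A_k$ need not have rank $k$. *)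

(* Defs.v *)
From HB Require Import structures.
From mathcomp Require Import all_boot all_order all_algebra.
From mathcomp Require Import all_classical all_reals all_analysis.
From mathcomp Require Import ring.

Set Implicit Arguments.
Unset Strict Implicit.
Unset Printing Implicit Defensive.

Import Order.TTheory GRing.Theory Num.Theory.
Import numFieldNormedType.Exports.

Local Open Scope classical_set_scope.
Local Open Scope ring_scope.

Section LinearAlgebra.
Context {R : realType}.

(* The library norm `|A| on matrices is the max norm, hence the following two. *)
Definition norm2 n (x : 'cV[R]_n) : R := Num.sqrt (\sum_i x i 0 ^+ 2).

Definition normF m n (A : 'M[R]_(m, n)) : R :=
  Num.sqrt (\sum_i \sum_j A i j ^+ 2).

Definition orthonormal_cols m n (Q : 'M[R]_(m, n)) : Prop :=
  Q^T *m Q = 1%:M.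

Definition rect_diag m n (s : seq R) : 'M[R]_(m, n) :=
  \matrix_(i, j) (if i == j :> nat then s`_i else 0).

(* Full singular value decomposition A = U * Sigma * V^T. *)
Definition is_svd m n (A : 'M[R]_(m, n)) (U : 'M[R]_m) (s : seq R)
    (V : 'M[R]_n) : Prop :=
  [/\ orthonormal_cols U /\ orthonormal_cols V,
      size s = minn m n,
      all (fun x => 0 <= x) s,
      sorted (fun x y => y <= x) s
    & A = U *m rect_diag m n s *m V^T].

(* xget is legitimate here: see svd_exists and singular_values_unique. *)
Definition singular_values m n (A : 'M[R]_(m, n)) : seq R :=
  xget [::] [set s | exists U V, is_svd A U s V].

(* Indexed from 1: sigma A 1 is the largest singular value. *)
Definition sigma m n (A : 'M[R]_(m, n)) (j : nat) : R :=
  (singular_values A)`_(j.-1).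

Definition sigma_max m n (A : 'M[R]_(m, n)) : R := sigma A 1.

Definition sigma_min m n (A : 'M[R]_(m, n)) : R := sigma A (minn m n).

(* When sigma_k = sigma_(k+1) there are several truncations of rank k. *)
Definition is_truncated_svd k m n (A B : 'M[R]_(m, n)) : Prop :=
  exists U s V, is_svd A U s V /\ B = U *m rect_diag m n (take k s) *m V^T.

(* The four Penrose equations. *)
Definition is_moore_penrose m n (A : 'M[R]_(m, n)) (X : 'M[R]_(n, m)) : Prop :=
  [/\ A *m X *m A = A, X *m A *m X = X,
      (A *m X)^T = A *m X & (X *m A)^T = X *m A].

(* The library's pinvmx is only a one-sided partial inverse, hence this
   definition; see moore_penroseP and moore_penrose_unique. *)
Definition moore_penrose m n (A : 'M[R]_(m, n)) : 'M[R]_(n, m) :=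
  xget 0 [set X | is_moore_penrose A X].

Definition glu m n l' l (A : 'M[R]_(m, n)) (U : 'M[R]_(l', m))
    (V : 'M[R]_(n, l)) : 'M[R]_(m, n) :=
  let B := U *m A *m V in
  (moore_penrose U *m (1%:M - B *m moore_penrose B) + A *m V *m moore_penrose B) *m (U *m A).

(* Existence and uniqueness facts that make the definitions by choice
   meaningful. *)
Let sq n (x : 'cV[R]_n) : R := \sum_i x i 0 ^+ 2.

Let sqE n (x : 'cV[R]_n) : x^T *m x = (sq x)%:M.
Proof.
apply/matrixP => i j; rewrite !ord1 !mxE eqxx mulr1n.
by apply: eq_bigr => k _; rewrite !mxE expr2.
Qed.

Let sq_ge0 n (x : 'cV[R]_n) : 0 <= sq x.
Proof. by apply: sumr_ge0 => i _; exact: sqr_ge0. Qed.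

Let sq_eq0 n (x : 'cV[R]_n) : sq x = 0 -> x = 0.
Proof.
move=> /eqP; rewrite psumr_eq0 => [/allP x0|i _]; last exact: sqr_ge0.
apply/matrixP => i j; rewrite ord1 !mxE; apply/eqP.
by have := x0 i (mem_index_enum _); rewrite sqrf_eq0.
Qed.

Let gram_unit m n (F : 'M[R]_(m, n)) : row_free F -> F *m F^T \in unitmx.
Proof.
move=> fF; rewrite -row_free_unit -kermx_eq0; apply/eqP/row_matrixP => i.
rewrite row0; set x := row i _; have xK : x *m (F *m F^T) = 0.
  by rewrite -row_mul mulmx_ker row0.
apply: (row_free_inj fF); rewrite mul0mx -[LHS]trmxK -[RHS]trmxK.
congr _^T; rewrite trmx0; apply: sq_eq0.
have := congr1 (fun M : 'M[R]_1 => M 0 0) (sqE (x *m F)^T).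
by rewrite trmxK trmx_mul mulmxA -(mulmxA x) xK mul0mx !mxE mulr1n.
Qed.

Lemma moore_penrose_exists m n (A : 'M[R]_(m, n)) : exists X, is_moore_penrose A X.
Proof.
have [r [C [F [AE HC HF]]]] : exists r (C : 'M[R]_(m, r)) (F : 'M[R]_(r, n)),
    [/\ A = C *m F, C^T *m C \in unitmx & F *m F^T \in unitmx].
  exists (\rank A), (col_base A), (row_base A); split.
  - by rewrite mulmx_base.
  - have := @gram_unit _ _ (col_base A)^T; rewrite trmxK; apply.
    by rewrite /row_free mxrank_tr; exact: col_base_full.
  - by apply: gram_unit; exact: row_base_free.
pose X := F^T *m invmx (F *m F^T) *m (invmx (C^T *m C) *m C^T).
have AX : A *m X = C *m invmx (C^T *m C) *m C^T.
  by rewrite AE /X !mulmxA -(mulmxA C F) mulmxK.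
have XA : X *m A = F^T *m invmx (F *m F^T) *m F.
  by rewrite AE /X !mulmxA -(mulmxA _ C^T) mulmxKV.
exists X; split.
- by rewrite AX AE !mulmxA -(mulmxA _ C^T) mulmxKV.
- by rewrite XA /X !mulmxA -(mulmxA _ F) mulmxKV.
- by rewrite AX !trmx_mul trmx_inv trmx_mul trmxK mulmxA.
- by rewrite XA !trmx_mul trmx_inv trmx_mul trmxK mulmxA.
Qed.

Lemma moore_penroseP m n (A : 'M[R]_(m, n)) : is_moore_penrose A (moore_penrose A).
Proof. exact: (xgetPex 0 (moore_penrose_exists A)). Qed.

Lemma moore_penrose_unique m n (A : 'M[R]_(m, n)) X : is_moore_penrose A X -> X = moore_penrose A.
Proof.
move=> [a b c d]; have [a' b' c' d'] := moore_penroseP A; set Y := moore_penrose A in a' b' c' d' *.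
have e1 : A *m X = A *m X *m (A *m Y).
  rewrite -{2}c -c' -trmx_mul.
  by rewrite (_ : A *m Y *m (A *m X) = A *m X) ?c // mulmxA a'.
have e2 : Y *m A = X *m A *m (Y *m A).
  rewrite -d -{2}d' -trmx_mul.
  by rewrite (_ : Y *m A *m (X *m A) = Y *m A) ?d' // mulmxA -!(mulmxA Y) a.
have XE : X = X *m A *m Y by rewrite -{1}b -mulmxA e1 !mulmxA b.
by rewrite XE -[RHS]b' e2 -!mulmxA (mulmxA Y A Y) b'.
Qed.

Let sum_cont p n (h : 'I_n -> 'rV[R]_p -> R) :
  (forall i, continuous (h i)) -> continuous (fun x => \sum_i h i x).
Proof.
move=> hc; apply: continuous_big => [|i _]; last exact: hc.
by move=> x; apply: cvgD; [exact: cvg_fst|exact: cvg_snd].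
Qed.

Let sq_max m n (A : 'M[R]_(m, n.+1)) : exists v : 'cV[R]_n.+1,
  sq v = 1 /\ forall x, sq (A *m x) <= sq (A *m v) * sq x.
Proof.
pose S := [set x : 'rV[R]_n.+1 | sq x^T = 1].
pose f (x : 'rV[R]_n.+1) := sq (A *m x^T).
have sqc p (g : 'rV[R]_n.+1 -> 'cV[R]_p) :
    (forall i, continuous (fun x => g x i 0)) -> continuous (fun x => sq (g x)).
  move=> gc; apply: sum_cont => i x.
  by apply: (@continuous_comp _ _ _ (fun x => g x i 0) (fun y : R => y ^+ 2));
    [exact: gc|exact: exprn_continuous].
have fc : continuous f.
  apply: sqc => i.
  rewrite (_ : (fun x => _) = (fun x : 'rV_n.+1 => \sum_j A i j * x 0 j)); last first.
    by apply/funext => x; rewrite mxE; apply: eq_bigr => j _; rewrite mxE.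
  apply: sum_cont => j x.
  by apply: (@continuous_comp _ _ _ (fun x : 'rV[R]_n.+1 => x 0 j) (fun y : R => A i j * y));
    [exact: coord_continuous|exact: mulrl_continuous].
have Sc : continuous (fun x : 'rV[R]_n.+1 => sq x^T).
  apply: sqc => i; rewrite (_ : (fun x => _) = (fun x : 'rV_n.+1 => x 0 i)).
    exact: coord_continuous.
  by apply/funext => x; rewrite mxE.
have S0 : S !=set0.
  exists (delta_mx 0 0); rewrite /S /= /sq (bigD1 0) //= big1 => [|i i0].
    by rewrite !mxE eqxx expr1n addr0.
  by rewrite !mxE eqxx (negPf i0) expr0n.
have Sco : compact S.
  apply: (subclosed_compact _ (@rV_compact _ _ (fun=> `[(-1 : R), 1]%classic) _)).
  - rewrite (_ : S = (fun x : 'rV[R]_n.+1 => sq x^T) @^-1` [set 1]) //.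
    by apply: preimage_closed => //; exact: closed_eq.
  - by move=> _; exact: segment_compact.
  - move=> x /= Sx i; rewrite /= in_itv /= -ler_norml.
    rewrite -[leRHS]normr1 -ler_sqr ?nnegrE// real_normK ?num_real// normr1 expr1n.
    rewrite -Sx /sq (bigD1 i) //= !mxE lerDl.
    by apply: sumr_ge0 => *; exact: sqr_ge0.
have [c cS cmax] := compact_EVT_max S0 Sco (continuous_subspaceT fc).
exists c^T; split; first by move: cS; rewrite inE.
move=> x; have [x0|xn0] := eqVneq (sq x) 0.
  by rewrite (sq_eq0 x0) mulmx0 [sq 0](_ : _ = 0) ?mulr0 // /sq big1 // => i _; rewrite mxE expr0n.
have sqZ p a (y : 'cV[R]_p) : sq (a *: y) = a ^+ 2 * sq y.
  by rewrite /sq mulr_sumr; apply: eq_bigr => i _; rewrite !mxE exprMn.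
have xp : 0 < sq x by rewrite lt_neqAle eq_sym xn0 sq_ge0.
set a := Num.sqrt (sq x).
have a2 : a ^+ 2 = sq x by rewrite sqr_sqrtr ?sq_ge0.
have : f (a^-1 *: x)^T <= f c.
  apply: cmax; rewrite inE /S /= trmxK sqZ exprVn a2 mulVf //.
by rewrite /f trmxK -scalemxAr sqZ exprVn a2 ler_pdivrMl // mulrC.
Qed.

Let complete_unit n (u : 'cV[R]_n.+1) : sq u = 1 ->
  exists Q : 'M[R]_n.+1, orthonormal_cols Q /\ col 0 Q = u.
Proof.
move=> u1; pose e : 'cV[R]_n.+1 := delta_mx 0 0.
have uu : u^T *m u = 1%:M by rewrite sqE u1.
have ee : e^T *m e = 1%:M.
  by rewrite trmx_delta mul_delta_mx; apply/matrixP => i j; rewrite !ord1 !mxE.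
pose w := u - e; have [w0|wn0] := eqVneq (sq w) 0.
  exists 1%:M; split; first by rewrite /orthonormal_cols trmx1 mulmx1.
  have /eqP := sq_eq0 w0; rewrite subr_eq0 => /eqP ->.
  by apply/matrixP => i j; rewrite !mxE ord1 eqxx andbT.
have ww := sqE w.
pose Q := 1%:M - (2 / sq w) *: (w *m w^T).
have QT : Q^T = Q.
  by rewrite /Q linearB /= linearZ /= trmx1 trmx_mul trmxK.
have QQ : Q *m Q = 1%:M.
  have WW : (w *m w^T) *m (w *m w^T) = sq w *: (w *m w^T).
    by rewrite mulmxA -(mulmxA w) ww mul_mx_scalar scalemxAl.
  rewrite /Q mulmxBl mul1mx mulmxBr mulmx1 -scalemxAl -scalemxAr WW !scalerA.
  rewrite opprB addrA addrAC -[RHS]addr0 -!addrA; congr (_ + _).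
  rewrite -![- (_ *: (w *m w^T))]scaleNr -!scalerDl (_ : _ + _ = 0) ?scale0r//.
  by field.
exists Q; split; first by rewrite /orthonormal_cols QT.
have -> : col 0 Q = Q *m e.
  by rewrite colE.
have t11 (N : 'M[R]_1) : N^T = N by apply/matrixP => i j; rewrite !ord1 mxE.
have eu : u^T *m e = e^T *m u by rewrite -[LHS]t11 trmx_mul trmxK.
have wT : w^T = u^T - e^T by rewrite linearB.
have sw : (sq w)%:M = 1%:M + 1%:M - (e^T *m u + e^T *m u) :> 'M[R]_1.
  rewrite -ww wT /w mulmxBl !mulmxBr uu ee eu opprB opprD !addrA.
  by congr (_ - _); rewrite addrAC.
have we : w^T *m e = (- (sq w / 2))%:M.
  rewrite wT mulmxBl ee eu; apply/matrixP => i j.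
  have := congr1 (fun N : 'M[R]_1 => N 0 0) sw; rewrite !ord1 mxE eqxx mulr1n => ->.
  set x := e^T *m u; rewrite ![in RHS]mxE ![in LHS]mxE /= !mulr1n.
  by field.
rewrite /Q mulmxBl mul1mx -scalemxAl -mulmxA we mul_mx_scalar scalerA.
rewrite (_ : 2 / sq w * _ = -1); last by field.
by rewrite scaleN1r opprK /w addrCA subrr addr0.
Qed.

Let sq_orth n (Q : 'M[R]_n) x : orthonormal_cols Q -> sq (Q *m x) = sq x.
Proof.
move=> oQ; have := sqE (Q *m x).
rewrite trmx_mul mulmxA -(mulmxA _ Q^T) oQ mulmx1 sqE.
by move=> /(congr1 (fun M : 'M[R]_1 => M 0 0)); rewrite !mxE !mulr1n.
Qed.

Let orthT n (Q : 'M[R]_n) : orthonormal_cols Q -> Q *m Q^T = 1%:M.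
Proof. exact: mulmx1C. Qed.

Let svd_aux p : forall m n (A : 'M[R]_(m, n)), (m + n <= p)%N ->
  exists U s V, is_svd A U s V.
Proof.
elim: p => [|p IHp] [|m] [|n] // A.
- exists 1%:M, [::], 1%:M.
  split=> //; last by apply/matrixP => -[].
  by rewrite /orthonormal_cols !trmx1 !mulmx1.
- exists 1%:M, [::], 1%:M.
  split=> //; last by apply/matrixP => -[].
  by rewrite /orthonormal_cols !trmx1 !mulmx1.
- exists 1%:M, [::], 1%:M.
  split=> //; last by apply/matrixP => -[].
  by rewrite /orthonormal_cols !trmx1 !mulmx1.
- exists 1%:M, [::], 1%:M.
  split; rewrite ?minn0 //; last by apply/matrixP => ? -[].
  by rewrite /orthonormal_cols !trmx1 !mulmx1.
rewrite addSn addnS ltnS => lep.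
have [v [v1 Av]] := sq_max A.
have [A0|An0] := eqVneq (sq (A *m v)) 0.
  have {A0} -> : A = 0.
    apply/matrixP => i j; rewrite mxE.
    have : sq (A *m delta_mx j 0) = 0.
      by apply/eqP; rewrite eq_le sq_ge0 andbT; have := Av (delta_mx j 0); rewrite A0 mul0r.
    by move=> /sq_eq0; rewrite -colE => /matrixP/(_ i 0); rewrite !mxE.
  exists 1%:M, (nseq (minn m.+1 n.+1) 0), 1%:M; split.
  - by rewrite /orthonormal_cols !trmx1 !mulmx1.
  - by rewrite size_nseq.
  - by apply/allP => x /nseqP[->].
  - by elim: (minn _ _) => //= k; case: k => //= k ->; rewrite lexx.
  - rewrite trmx1 mulmx1 mul1mx; apply/matrixP => i j; rewrite !mxE.
    by rewrite nth_nseq !if_same.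
pose sg := Num.sqrt (sq (A *m v)).
have sg2 : sg ^+ 2 = sq (A *m v) by rewrite sqr_sqrtr.
have sg0 : 0 < sg by rewrite sqrtr_gt0 lt_neqAle eq_sym An0 sq_ge0.
have u1 : sq (sg^-1 *: (A *m v)) = 1.
  rewrite /sq (eq_bigr (fun i => sg^-2 * (A *m v) i 0 ^+ 2)).
    by rewrite -mulr_sumr -/(sq _) -sg2 mulVf // expf_neq0 // gt_eqF.
  by move=> i _; rewrite mxE exprMn exprVn.
have [Qu [oQu cu]] := complete_unit u1.
have [Qv [oQv cv]] := complete_unit v1.
pose M : 'M[R]_(1 + m, 1 + n) := Qu^T *m A *m Qv.
have AM : A = Qu *m M *m Qv^T.
  by rewrite /M !mulmxA orthT // mul1mx -mulmxA orthT // mulmx1.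
have Mb x : sq (M *m x) <= sg ^+ 2 * sq x.
  rewrite sg2 -(sq_orth x oQv) /M -!mulmxA -(sq_orth (Qu^T *m (A *m (Qv *m x))) oQu) (mulmxA Qu) orthT // mul1mx.
  exact: Av.
have cM : col 0 M = sg *: delta_mx 0 0.
  have -> : col 0 M = Qu^T *m (A *m v) by rewrite !colE -cv colE !mulmxA.
  have -> : A *m v = sg *: (sg^-1 *: (A *m v)).
    by rewrite scalerA mulfV ?scale1r // gt_eqF.
  by rewrite -cu colE -scalemxAr mulmxA oQu mul1mx.
clearbody M; pose r := ursubmx M; pose B := drsubmx M.
have ME : M = block_mx sg%:M r 0 B.
  rewrite -[LHS]submxK; congr block_mx.
    apply/matrixP => i j; rewrite !ord1.
    have /matrixP/(_ 0 0) := cM; rewrite !mxE !eqxx mulr1 mulr1n => <-.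
    by congr (M _ _); apply: val_inj.
  apply/matrixP => i j; rewrite !ord1.
  have /matrixP/(_ (rshift 1 i) 0) := cM; rewrite !mxE /= mulr0 => <-.
  by congr (M _ _); apply: val_inj.
have sqcol p1 p2 (x : 'cV[R]_p1) (y : 'cV[R]_p2) : sq (col_mx x y) = sq x + sq y.
  rewrite /sq big_split_ord /=.
  by congr (_ + _); apply: eq_bigr => i _; rewrite ?col_mxEu ?col_mxEd.
have sqs (a : R) : sq (a%:M : 'cV_1) = a ^+ 2.
  by rewrite /sq big_ord1 !mxE mulr1n.
have r0 : r = 0.
  have := Mb (col_mx sg%:M r^T).
  rewrite ME mul_block_col sqcol mul0mx add0r -scalar_mxM -{1}[r]trmxK sqE -raddfD /=.
  rewrite sqs sqcol sqs; set rho := sq r^T => H.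
  have : (sg ^+ 2 + rho) ^+ 2 <= sg ^+ 2 * (sg ^+ 2 + rho).
    by apply: le_trans H; rewrite -expr2 lerDl sq_ge0.
  rewrite expr2 ler_pM2r; last by rewrite ltr_wpDr ?sq_ge0 // exprn_gt0.
  rewrite gerDl => rho0; have /sq_eq0 : rho = 0 by apply/eqP; rewrite eq_le rho0 sq_ge0.
  by move=> /(congr1 trmx); rewrite trmxK trmx0.
have Bb x : sq (B *m x) <= sg ^+ 2 * sq x.
  have := Mb (col_mx 0 x); rewrite ME mul_block_col !mulmx0 r0 mul0mx !add0r !sqcol.
  by rewrite [sq 0](_ : _ = 0) ?add0r // /sq big1 // => i _; rewrite mxE expr0n.
have [U [s [V [[oU oV] szs s0 srt BE]]]] := IHp _ _ B (leq_trans (leqnSn _) lep).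
exists (Qu *m (block_mx 1%:M 0 0 U : 'M[R]_(1 + m))), (sg :: s),
  (Qv *m (block_mx 1%:M 0 0 V : 'M[R]_(1 + n))).
have ob q (Q : 'M[R]_q) : orthonormal_cols Q ->
    orthonormal_cols (block_mx 1%:M 0 0 Q : 'M[R]_(1 + q)).
  rewrite /orthonormal_cols => oQ; rewrite tr_block_mx mulmx_block oQ !trmx0.
  by rewrite !(mul0mx, mulmx0, addr0, add0r) trmx1 mulmx1 -scalar_mx_block.
have om q (Q1 Q2 : 'M[R]_q) : orthonormal_cols Q1 -> orthonormal_cols Q2 ->
    orthonormal_cols (Q1 *m Q2).
  by rewrite /orthonormal_cols => h1 h2; rewrite trmx_mul mulmxA -(mulmxA _ Q1^T) h1 mulmx1.
split.
- by split; apply: om => //; exact: ob.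
- by rewrite /= szs minnSS.
- by rewrite /= ltW.
- case: s szs {s0 srt} BE (s0) (srt) => //= a s szs BE /andP[a0 _] srt.
  rewrite srt andbT -ler_sqr ?nnegrE ?(ltW sg0) //.
  have /andP[m0 n0] : (0 < m)%N && (0 < n)%N by rewrite -leq_min -szs.
  have := Bb (V *m delta_mx (Ordinal n0) 0).
  rewrite BE -!mulmxA (mulmxA V^T) oV mul1mx !sq_orth //.
  rewrite {2}/sq (bigD1 (Ordinal n0)) //= !mxE !eqxx /= expr1n big1; last first.
    by move=> i /negPf i0; rewrite mxE i0 expr0n.
  rewrite addr0 mulr1; apply: le_trans.
  rewrite /sq (bigD1 (Ordinal m0)) //= mxE (bigD1 (Ordinal n0)) //= !mxE !eqxx /= mulr1.
  rewrite big1 ?addr0; last by move=> i /negPf i0; rewrite [X in _ * X]mxE i0 mulr0.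
  by rewrite lerDl; apply: sumr_ge0 => *; exact: sqr_ge0.
- rewrite [in LHS]AM ME r0 !trmx_mul -!mulmxA; congr (_ *m _).
  rewrite !mulmxA; congr (_ *m _).
  have -> : rect_diag m.+1 n.+1 (sg :: s) = block_mx sg%:M 0 0 (rect_diag m n s) :> 'M[R]_(1 + m, 1 + n).
    rewrite -[LHS](@submxK _ 1 m 1 n); congr block_mx; apply/matrixP => i j; rewrite ?ord1 !mxE //.
  rewrite (@tr_block_mx _ 1 n 1 n) !(@mulmx_block _ 1 m 1 m 1 n) (@mulmx_block _ 1 m 1 n 1 n) !trmx0 !(mul0mx, mulmx0, addr0, add0r, mul1mx, trmx1, mulmx1).
  by rewrite -BE.
Qed.

Lemma svd_exists m n (A : 'M[R]_(m, n)) : exists U s V, is_svd A U s V.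
Proof. exact: svd_aux (leqnn _). Qed.

Lemma singular_valuesP m n (A : 'M[R]_(m, n)) :
  exists U V, is_svd A U (singular_values A) V.
Proof.
apply: (@xgetPex _ [::] [set s | exists U V, is_svd A U s V]).
by have [U [s [V H]]] := svd_exists A; exists s, U, V.
Qed.

Let svd_char_poly m n (A : 'M[R]_(m, n)) U s V : is_svd A U s V ->
  char_poly (A *m A^T) = \prod_(x <- mkseq (fun i => s`_i ^+ 2) m) ('X - x%:P).
Proof.
move=> [[oU oV] szs _ _ ->]; set S := rect_diag m n s.
have -> : U *m S *m V^T *m (U *m S *m V^T)^T = U *m (S *m S^T) *m U^T.
  by rewrite !trmx_mul trmxK !mulmxA -(mulmxA _ V^T) oV mulmx1.
set D := S *m S^T.
have DE i j : D i j = if i == j then s`_i ^+ 2 else 0.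
  rewrite mxE; have [im|mi] := ltnP i n; last first.
    rewrite big1 => [|k _].
      by rewrite nth_default ?expr0n ?if_same // szs geq_min mi orbT.
    by rewrite !mxE gtn_eqF ?mul0r // (leq_trans _ mi).
  rewrite (bigD1 (Ordinal im)) //= big1 ?addr0 => [|k ki].
    rewrite !mxE /= eqxx -val_eqE /= [in RHS]eq_sym.
    by case: eqP => [->|_]; rewrite ?mulr0 ?expr2.
  by rewrite !mxE eq_sym (_ : (k == i :> nat) = false) ?mul0r //; exact: negbTE.
clearbody D.
have -> : char_poly (U *m D *m U^T) = char_poly D.
  have oU' : map_mx polyC U *m (map_mx polyC U)^T = 1%:M.
    by rewrite map_trmx -map_mxM mulmx1C // map_mx1.
  rewrite /char_poly /char_poly_mx !map_mxM -map_trmx.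
  set W := map_mx polyC U in oU' *; set E := map_mx _ D.
  have -> : 'X%:M - W *m E *m W^T = W *m ('X%:M - E) *m W^T.
    by rewrite mulmxBr mulmxBl mul_mx_scalar -scalemxAl oU' scalemx1.
  by rewrite !det_mulmx mulrAC -det_mulmx oU' det1 mul1r.
rewrite char_poly_trig; last first.
  by apply/is_trig_mxP => i j ij; rewrite DE -val_eqE ltn_eqF.
rewrite big_map -[m in iota 0 m]subn0 -/(index_iota 0 m) big_mkord.
by apply: eq_bigr => i _; rewrite DE eqxx.
Qed.

Lemma singular_values_unique m n (A : 'M[R]_(m, n)) U s V :
  is_svd A U s V -> singular_values A = s.
Proof.
have [U' [V']] := singular_valuesP A; set t := singular_values A => Ht Hs.
have := svd_char_poly Ht; rewrite (svd_char_poly Hs) => /prod_XsubC_eq.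
move: Ht Hs => [_ szt t0 tt _] [_ szs s0 ss _].
have nn0 (r : seq R) : all (fun x => 0 <= x) r -> forall i, 0 <= r`_i.
  by move=> r0 i; have [/(mem_nth 0)/(allP r0)|ri] := ltnP i (size r); rewrite // nth_default.
have sq_sorted (r : seq R) : all (fun x => 0 <= x) r ->
    sorted (fun x y => y <= x) r ->
    sorted (fun x y => y <= x) (mkseq (fun i => r`_i ^+ 2) m).
  move=> r0 rs; apply/(sortedP 0) => i; rewrite size_mkseq => im.
  rewrite !nth_mkseq ?(ltnW im) //; rewrite ler_sqr ?nnegrE ?nn0 //.
  have [ir|ri] := ltnP i.+1 (size r); first by move/(sortedP 0): rs; exact.
  by rewrite (nth_default _ ri) nn0.
move=> /(sorted_eq _ _ (sq_sorted _ s0 ss) (sq_sorted _ t0 tt)) E.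
apply: (@eq_from_nth _ 0); first by rewrite szt szs.
rewrite szt => i; rewrite leq_min => /andP[im _].
have : s`_i ^+ 2 = t`_i ^+ 2.
  rewrite -[LHS](nth_mkseq 0 (fun i => s`_i ^+ 2) im) E ?nth_mkseq //.
    by move=> x y z /= yx xz; exact: le_trans yx.
  by move=> x y /andP[xy yx]; apply/eqP; rewrite eq_le xy yx.
by move=> /eqP; rewrite eqrXn2 ?nn0 // => /eqP.
Qed.
End LinearAlgebra.

(* Matrices carry the sigma-algebra generated by their entries. *)
Definition mx_display : measure_display.
Proof. exact. Qed.

Section MeasurableMatrix.
Context {R : realType} (m n : nat).

Definition mx_entry_preimages : set (set 'M[R]_(m, n)) :=
  [set A | exists i j (B : set R),
     measurable B /\ A = [set M : 'M[R]_(m, n) | B (M i j)]].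

Let mx_set0 : <<s mx_entry_preimages >> set0.
Proof. exact: sigma_algebra0. Qed.

Let mx_setC A : <<s mx_entry_preimages >> A -> <<s mx_entry_preimages >> (~` A).
Proof. exact: sigma_algebraC. Qed.

Let mx_bigcup (F : (set 'M[R]_(m, n))^nat) :
  (forall i, <<s mx_entry_preimages >> (F i)) ->
  <<s mx_entry_preimages >> (\bigcup_i F i).
Proof. exact: sigma_algebra_bigcup. Qed.

HB.instance Definition _ := @isMeasurable.Build mx_display 'M[R]_(m, n)
  <<s mx_entry_preimages >> mx_set0 mx_setC mx_bigcup.

End MeasurableMatrix.

Section Probability.
Context {R : realType}.

(* "The event E holds with probability at least p", without presupposing that
   E is measurable. *)
Definition with_prob_ge d (T : measurableType d) (P : probability T R) (p : R)
    (E : set T) : Prop :=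
  exists F : set T, [/\ measurable F, F `<=` E & (p%:E <= P F)%E].

Definition drawn_from d d' (Omega : measurableType d) (T : measurableType d')
    (P : probability Omega R) (X : Omega -> T) (mu : probability T R) : Prop :=
  measurable_fun setT X /\
  forall B : set T, measurable B -> P (X @^-1` B) = mu B.

Definition independent d d1 d2 (Omega : measurableType d)
    (T1 : measurableType d1) (T2 : measurableType d2)
    (P : probability Omega R) (X : Omega -> T1) (Y : Omega -> T2) : Prop :=
  forall (B : set T1) (C : set T2), measurable B -> measurable C ->
    P (X @^-1` B `&` Y @^-1` C) = (P (X @^-1` B) * P (Y @^-1` C))%E.

Definition JLT n s (eps delta : R) (N : nat)
    (mu : probability 'M[R]_(s, n) R) : Prop :=
  forall T : seq 'cV[R]_n,
    uniq T -> size T = N -> (forall x, x \in T -> norm2 x = 1) ->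
    with_prob_ge mu (1 - delta)
      [set U : 'M[R]_(s, n) | forall x, x \in T ->
         1 - eps <= norm2 (U *m x) ^+ 2 <= 1 + eps].

Definition OSE n s (k : nat) (eps delta : R)
    (mu : probability 'M[R]_(s, n) R) : Prop :=
  (k <= s)%N /\
  forall Q : 'M[R]_(n, k), orthonormal_cols Q ->
    with_prob_ge mu (1 - delta)
      [set U : 'M[R]_(s, n) |
         [/\ 1 - eps <= sigma_min (U *m Q),
             sigma_min (U *m Q) <= sigma_max (U *m Q)
           & sigma_max (U *m Q) <= 1 + eps]].

End Probability.

(* Main.v *)
(** Write [D = A V_1], [B = U_1 D] and [Theta = D B^+ U_1]. As [B^+ B = 1] one gets
[A_k V_1 = A V_1], [Theta D = D] and
[A - A_k = (1 - U_1^+ U_1) (1 - Theta) A], so everything reduces to three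
properties of a random [S] (namely [V_1^T] with [Q] the leading right singular
vectors of [A], and [U_1] with [Q] an orthonormal basis of the range of [D]):
[S Q] is bounded below, [|S| <= C sqrt(N / k)], and
[|Q^T S^T S G|_F^2 <= C eps |G|_F^2] for a fixed [G] orthogonal to [Q].

The embedding property controls one [k]-dimensional space at a time, whereas the
budget for each of the two matrices is exactly [2 delta]. Hence a finite family
of tests [Q + t H_z] is used, where [t] runs over six geometric scales and [z]
over a finite family of random vectors with integer entries such that [L z] is
rarely small compared to [|L|_F], for all matrices [L]. If [S] violates one of
the properties then it fails at least half of the tests, and each test fails
with probability at most [delta]; by Markov's inequality the violation has
probability at most [2 delta].

For [U_1] the space spanned by [Q] depends on [V_1]; Fubini's theorem applies since
the relevant events are measurable in the pair. *)
Require Import Defs.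
From mathcomp Require Import all_boot all_order all_algebra.
From mathcomp Require Import all_classical all_reals all_analysis.
From mathcomp Require Import measurable_realfun ring lra zify.
Import Order.TTheory GRing.Theory Num.Theory.
Local Open Scope classical_set_scope.
Local Open Scope ring_scope.

Set Implicit Arguments.
Unset Strict Implicit.
Unset Printing Implicit Defensive.

(** * Euclidean and Frobenius norms *)

Section Euclidean.
Context {R : realType}.

(** The embedding property could also bound [|S|] by cutting the coordinates into about [N / k]
    blocks, but a union bound would multiply [delta] by the number of blocks, and testing the lower
    bound on [S Q] by itself would spend a further [delta]. This is why every test contains [Q]: one
    family serves both properties needed of a matrix. The proportion one half is [3/4 * 4/6].
    Anti-concentration makes at least three quarters of the vectors [z] useful, and a violation lets
    a useful [z] pass at most two of the six scales. Two passed scales already contradict a failure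
    of the lower bound or of the norm bound. The product [Q^T S^T S G] needs three, because
    [|S (Q + t H) x|^2] is a quadratic polynomial in [t] of which only the linear coefficient
    matters. The perturbations [H_z] must be contractions under an absolute normalisation, so the
    entries of [z] have to be bounded independently of the dimension. This excludes Gaussian
    vectors, and the quarter excludes plain sign vectors: for [L = (1, -1)] half of them give
    [L z = 0]. *)

Definition dot n (x y : 'cV[R]_n) : R := \sum_i x i 0 * y i 0.

Lemma dotE n (x y : 'cV[R]_n) : dot x y = (x^T *m y) 0 0.
Proof. by rewrite mxE; apply: eq_bigr => i _; rewrite mxE. Qed.

Lemma dotC n (x y : 'cV[R]_n) : dot x y = dot y x.
Proof. by apply: eq_bigr => i _; rewrite mulrC. Qed.

Lemma dotDl n (x y z : 'cV[R]_n) : dot (x + y) z = dot x z + dot y z.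
Proof. by rewrite /dot -big_split; apply: eq_bigr => i _; rewrite !mxE mulrDl. Qed.

Lemma dotDr n (x y z : 'cV[R]_n) : dot z (x + y) = dot z x + dot z y.
Proof. by rewrite dotC dotDl !(dotC z). Qed.

Lemma dotZl n a (x y : 'cV[R]_n) : dot (a *: x) y = a * dot x y.
Proof. by rewrite /dot mulr_sumr; apply: eq_bigr => i _; rewrite mxE mulrA. Qed.

Lemma dotZr n a (x y : 'cV[R]_n) : dot x (a *: y) = a * dot x y.
Proof. by rewrite dotC dotZl dotC. Qed.

Lemma dotNl n (x y : 'cV[R]_n) : dot (- x) y = - dot x y.
Proof. by rewrite -scaleN1r dotZl mulN1r. Qed.

Lemma dotNr n (x y : 'cV[R]_n) : dot x (- y) = - dot x y.
Proof. by rewrite dotC dotNl dotC. Qed.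

Lemma dot0r n (x : 'cV[R]_n) : dot x 0 = 0.
Proof. by rewrite /dot big1 // => i _; rewrite mxE mulr0. Qed.

Lemma dot_mull m n (A : 'M[R]_(m, n)) x y : dot (A *m x) y = dot x (A^T *m y).
Proof. by rewrite !dotE trmx_mul mulmxA. Qed.

Lemma dot_mulr m n (A : 'M[R]_(m, n)) x y : dot x (A *m y) = dot (A^T *m x) y.
Proof. by rewrite dot_mull trmxK. Qed.

Lemma dot_ge0 n (x : 'cV[R]_n) : 0 <= dot x x.
Proof. by apply: sumr_ge0 => i _; rewrite -expr2 sqr_ge0. Qed.

Lemma dot_eq0 n (x : 'cV[R]_n) : (dot x x == 0) = (x == 0).
Proof.
apply/eqP/eqP => [/eqP|->]; last exact: dot0r.
rewrite psumr_eq0 => [/allP x0|i _]; last by rewrite -expr2 sqr_ge0.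
apply/matrixP => i j; rewrite ord1 mxE; apply/eqP.
by have := x0 i (mem_index_enum _); rewrite /= -expr2 sqrf_eq0.
Qed.

Lemma dot_gt0 n (x : 'cV[R]_n) : (0 < dot x x) = (x != 0).
Proof. by rewrite lt_neqAle dot_ge0 andbT eq_sym dot_eq0. Qed.

Lemma norm2_ge0 n (x : 'cV[R]_n) : 0 <= norm2 x.
Proof. exact: sqrtr_ge0. Qed.

Lemma sqr_norm2 n (x : 'cV[R]_n) : norm2 x ^+ 2 = dot x x.
Proof.
rewrite /norm2 sqr_sqrtr; first by apply: eq_bigr => i _; rewrite expr2.
by apply: sumr_ge0 => i _; rewrite sqr_ge0.
Qed.

Lemma norm2E n (x : 'cV[R]_n) : norm2 x = Num.sqrt (dot x x).
Proof. by rewrite -sqr_norm2 sqrtr_sqr ger0_norm ?norm2_ge0. Qed.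

Lemma norm2_eq0 n (x : 'cV[R]_n) : (norm2 x == 0) = (x == 0).
Proof. by rewrite -dot_eq0 -sqr_norm2 sqrf_eq0. Qed.

Lemma norm2_gt0 n (x : 'cV[R]_n) : (0 < norm2 x) = (x != 0).
Proof. by rewrite lt_neqAle norm2_ge0 andbT eq_sym norm2_eq0. Qed.

Lemma norm2_0 n : norm2 (0 : 'cV[R]_n) = 0.
Proof. by apply/eqP; rewrite norm2_eq0. Qed.

Lemma norm2Z n a (x : 'cV[R]_n) : norm2 (a *: x) = `|a| * norm2 x.
Proof.
rewrite !norm2E dotZl dotZr mulrA -expr2 sqrtrM ?sqr_ge0 //.
by rewrite sqrtr_sqr.
Qed.

Lemma norm2N n (x : 'cV[R]_n) : norm2 (- x) = norm2 x.
Proof. by rewrite -scaleN1r norm2Z normrN1 mul1r. Qed.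

Lemma ler_norm2 m n (x : 'cV[R]_m) (y : 'cV[R]_n) (a : R) : 0 <= a ->
  (norm2 x <= a * norm2 y) = (dot x x <= a ^+ 2 * dot y y).
Proof.
move=> a0; rewrite -!sqr_norm2 -exprMn ler_sqr ?nnegrE ?norm2_ge0 //.
by rewrite mulr_ge0 ?norm2_ge0.
Qed.

Lemma cauchy_schwarz n (x y : 'cV[R]_n) : dot x y ^+ 2 <= dot x x * dot y y.
Proof.
have [->|yn0] := eqVneq y 0; first by rewrite !dot0r mulr0 expr0n.
have yp : 0 < dot y y by rewrite dot_gt0.
have := dot_ge0 (dot y y *: x - dot x y *: y).
rewrite dotDl !dotDr !(dotNl, dotNr) !(dotZl, dotZr) (dotC y x).
set a := dot x x; set b := dot y y in yp *; set c := dot x y => H.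
have : 0 <= b * (a * b - c ^+ 2) by apply: le_trans H _; rewrite expr2; lra.
by rewrite pmulr_rge0 // subr_ge0.
Qed.

Lemma ler_dot n (x y : 'cV[R]_n) : dot x y <= norm2 x * norm2 y.
Proof.
apply: (le_trans (ler_norm _)).
rewrite -ler_sqr ?nnegrE ?mulr_ge0 ?norm2_ge0 // real_normK ?num_real //.
by rewrite exprMn !sqr_norm2 cauchy_schwarz.
Qed.

Lemma ler_norm2D n (x y : 'cV[R]_n) : norm2 (x + y) <= norm2 x + norm2 y.
Proof.
rewrite -ler_sqr ?nnegrE ?addr_ge0 ?norm2_ge0 // sqrrD !sqr_norm2.
rewrite dotDl !dotDr (dotC y x).
have := ler_dot x y; lra.
Qed.

Lemma ler_norm2B n (x y : 'cV[R]_n) : norm2 (x - y) <= norm2 x + norm2 y.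
Proof. by have := ler_norm2D x (- y); rewrite norm2N. Qed.

Lemma lerB_norm2 n (x y : 'cV[R]_n) : norm2 x - norm2 y <= norm2 (x + y).
Proof. by rewrite lerBlDr; apply: le_trans (ler_norm2B _ _); rewrite addrK. Qed.

(** The bound on [S] is applied to the vector [S^T u] in [|S^T u|^2 = <u, S S^T u>]. Operator norms
    pass in this way between a sketch and its transpose. *)
Lemma norm2_dual m n (S : 'M[R]_(m, n)) a : 0 <= a ->
  (forall x, norm2 (S *m x) <= a * norm2 x) ->
  forall u, norm2 (S^T *m u) <= a * norm2 u.
Proof.
move=> a0 Sa u; have [->|n0] := eqVneq (S^T *m u) 0.
  by rewrite norm2_0 mulr_ge0 ?norm2_ge0.
rewrite -(ler_pM2l (_ : 0 < norm2 (S^T *m u))) ?norm2_gt0 //.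
rewrite -expr2 sqr_norm2 dot_mull trmxK (le_trans (ler_dot _ _)) //.
rewrite mulrA [X in _ <= X]mulrC ler_wpM2l ?norm2_ge0 //.
by rewrite (mulrC _ a).
Qed.

Definition fro2 m n (A : 'M[R]_(m, n)) : R := \sum_i \sum_j A i j ^+ 2.

Lemma fro2_ge0 m n (A : 'M[R]_(m, n)) : 0 <= fro2 A.
Proof. by apply: sumr_ge0 => i _; apply: sumr_ge0 => j _; exact: sqr_ge0. Qed.

Lemma sqr_normF m n (A : 'M[R]_(m, n)) : normF A ^+ 2 = fro2 A.
Proof. by rewrite /normF sqr_sqrtr // fro2_ge0. Qed.

Lemma fro2_col m n (A : 'M[R]_(m, n)) : fro2 A = \sum_j dot (col j A) (col j A).
Proof.
rewrite /fro2 exchange_big /=; apply: eq_bigr => j _.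
by apply: eq_bigr => i _; rewrite !mxE expr2.
Qed.

Lemma fro2_tr m n (A : 'M[R]_(m, n)) : fro2 A^T = fro2 A.
Proof.
rewrite [RHS]exchange_big; apply: eq_bigr => i _.
by apply: eq_bigr => j _; rewrite mxE.
Qed.

Lemma fro2_eq0 m n (A : 'M[R]_(m, n)) : fro2 A = 0 -> A = 0.
Proof.
rewrite fro2_col => /eqP; rewrite psumr_eq0 => [/allP A0|i _]; last exact: dot_ge0.
apply/matrixP => i j; have := A0 j (mem_index_enum _); rewrite /= dot_eq0.
by move=> /eqP/matrixP/(_ i 0); rewrite !mxE.
Qed.

Lemma fro20 m n : fro2 (0 : 'M[R]_(m, n)) = 0.
Proof. by rewrite /fro2 big1 // => i _; rewrite big1 // => j _; rewrite mxE expr0n. Qed.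

Lemma fro2Z m n a (A : 'M[R]_(m, n)) : fro2 (a *: A) = a ^+ 2 * fro2 A.
Proof.
rewrite /fro2 mulr_sumr; apply: eq_bigr => i _; rewrite mulr_sumr.
by apply: eq_bigr => j _; rewrite mxE exprMn.
Qed.

Lemma fro2N m n (A : 'M[R]_(m, n)) : fro2 (- A) = fro2 A.
Proof. by rewrite -scaleN1r fro2Z sqrrN expr1n mul1r. Qed.

Lemma fro2_le m n p (A : 'M[R]_(m, n)) (B : 'M[R]_(p, n)) a :
  (forall j, dot (col j A) (col j A) <= a * dot (col j B) (col j B)) ->
  fro2 A <= a * fro2 B.
Proof. by move=> H; rewrite !fro2_col mulr_sumr; apply: ler_sum => j _. Qed.

Lemma col_mul m n p (A : 'M[R]_(m, n)) (B : 'M[R]_(n, p)) j :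
  col j (A *m B) = A *m col j B.
Proof. by rewrite !colE mulmxA. Qed.

Lemma fro2D m n (A B : 'M[R]_(m, n)) : A^T *m B = 0 ->
  fro2 (A + B) = fro2 A + fro2 B.
Proof.
move=> AB; rewrite !fro2_col -big_split /=; apply: eq_bigr => j _.
have -> : col j (A + B) = col j A + col j B by rewrite linearD.
have o : dot (col j A) (col j B) = 0.
  transitivity ((A^T *m B) j j); last by rewrite AB mxE.
  by rewrite mxE; apply: eq_bigr => k _; rewrite !mxE.
by rewrite dotDl !dotDr (dotC (col j B)) o addr0 add0r.
Qed.

Lemma dot_orthonormal m n (Q : 'M[R]_(m, n)) x y :
  orthonormal_cols Q -> dot (Q *m x) (Q *m y) = dot x y.
Proof. by move=> oQ; rewrite dot_mull mulmxA oQ mul1mx. Qed.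

Lemma norm2_orthonormal m n (Q : 'M[R]_(m, n)) x :
  orthonormal_cols Q -> norm2 (Q *m x) = norm2 x.
Proof. by move=> oQ; rewrite !norm2E dot_orthonormal. Qed.

Lemma norm2_orthonormalT m n (Q : 'M[R]_(m, n)) x :
  orthonormal_cols Q -> norm2 (Q^T *m x) <= norm2 x.
Proof.
move=> oQ; rewrite -[leRHS]mul1r; apply: norm2_dual => // y.
by rewrite mul1r norm2_orthonormal.
Qed.

Lemma fro2_orthonormal m n p (Q : 'M[R]_(m, n)) (B : 'M[R]_(n, p)) :
  orthonormal_cols Q -> fro2 (Q *m B) = fro2 B.
Proof.
by move=> oQ; rewrite !fro2_col; apply: eq_bigr => j _; rewrite col_mul dot_orthonormal.
Qed.

Lemma fro2_proj m n (P : 'M[R]_m) (B : 'M[R]_(m, n)) :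
  P^T = P -> P *m P = P -> fro2 ((1%:M - P) *m B) <= fro2 B.
Proof.
move=> PT PP; rewrite -[leRHS]/(fro2 B) -[X in _ <= fro2 X](subrK (P *m B)).
have -> : B - P *m B = (1%:M - P) *m B by rewrite mulmxBl mul1mx.
rewrite fro2D ?lerDl ?fro2_ge0 // trmx_mul linearB /= trmx1 PT.
by rewrite -mulmxA (mulmxA _ P) mulmxBl mul1mx PP subrr mul0mx mulmx0.
Qed.

Lemma norm2_proj m (P : 'M[R]_m) (x : 'cV[R]_m) :
  P^T = P -> P *m P = P -> norm2 ((1%:M - P) *m x) <= norm2 x.
Proof.
move=> PT PP; have := fro2_proj x PT PP.
have E (y : 'cV[R]_m) : fro2 y = dot y y.
  by rewrite fro2_col big_ord1; congr dot; apply/matrixP => i j; rewrite !mxE !ord1.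
rewrite !E => H; rewrite -[leRHS]mul1r ler_norm2 //.
by rewrite expr1n mul1r.
Qed.

Lemma gram_unitmx m n (M : 'M[R]_(m, n)) :
  (forall x : 'cV_n, M *m x = 0 -> x = 0) -> M^T *m M \in unitmx.
Proof.
move=> inj; rewrite -row_free_unit -kermx_eq0; apply/eqP/row_matrixP => i.
rewrite row0; set x := row i (kermx _); have xK : x *m (M^T *m M) = 0.
  by rewrite -row_mul mulmx_ker row0.
have Kx : M^T *m M *m x^T = 0.
  by apply: trmx_inj; rewrite !trmx_mul !trmxK xK trmx0.
have x0 : x^T = 0.
  by apply: inj; apply/eqP; rewrite -dot_eq0 dot_mull mulmxA Kx dot0r.
by rewrite -[LHS]trmxK x0 trmx0.
Qed.

End Euclidean.

(** * Singular values *)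

Section SingularValues.
Context {R : realType}.

Definition top_cols n k (V : 'M[R]_n) : 'M[R]_(n, k) := V *m pid_mx k.

Section WithSvd.
Variables (m n : nat) (A : 'M[R]_(m, n)) (U : 'M[R]_m) (s : seq R) (V : 'M[R]_n).
Hypothesis svdA : is_svd A U s V.

Lemma svd_ge0 i : 0 <= s`_i.
Proof.
have [_ _ /allP s0 _ _] := svdA.
by have [/(mem_nth 0)/s0|/(nth_default 0)->] := ltnP i (size s).
Qed.

Lemma svd_decr i j : (i <= j)%N -> s`_j <= s`_i.
Proof.
move=> ij; have [js|sj] := ltnP j (size s); last by rewrite (nth_default _ sj) svd_ge0.
have [_ _ _ srt _] := svdA.
apply: (sorted_leq_nth _ _ 0 srt) => //; first by move=> x y z yx xz; exact: le_trans yx.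
by rewrite inE (leq_ltn_trans ij).
Qed.

(** The sum can run over all [n] coordinates because [s] reads 0 beyond its length [minn m n]. *)
Lemma svd_dot (x : 'cV[R]_n) :
  dot (A *m x) (A *m x) = \sum_(i < n) s`_i ^+ 2 * (V^T *m x) i 0 ^+ 2.
Proof.
have [[oU oV] szs _ _ ->] := svdA.
rewrite -!mulmxA dot_orthonormal //; set y := V^T *m x.
have E i : (rect_diag m n s *m y) i 0 = \sum_(j < n) (if i == j :> nat then s`_i * y j 0 else 0).
  by rewrite mxE; apply: eq_bigr => j _; rewrite mxE; case: ifP => //; rewrite mul0r.
have E2 i : (rect_diag m n s *m y) i 0 ^+ 2 =
    \sum_(j < n) (if i == j :> nat then s`_i ^+ 2 * y j 0 ^+ 2 else 0).
  rewrite E; have [im|mi] := ltnP i n; last first.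
    by rewrite !big1 ?expr0n // => j _; case: eqP => // e; have := ltn_ord j; rewrite -e ltnNge mi.
  rewrite (bigD1 (Ordinal im)) //= [in RHS](bigD1 (Ordinal im)) //= eqxx.
  rewrite !big1 ?addr0 ?exprMn // => j; rewrite -val_eqE /= eq_sym => /negPf -> //.
under [LHS]eq_bigr => i _ do rewrite -expr2 E2.
rewrite exchange_big /=; apply: eq_bigr => j _.
have [jm|mj] := ltnP j m; last first.
  rewrite big1 ?nth_default ?expr0n ?mul0r // ?szs ?geq_min ?mj //.
  by move=> i _; case: eqP => // e; have := ltn_ord i; rewrite e ltnNge mj.
rewrite (bigD1 (Ordinal jm)) //= eqxx big1 ?addr0 // => i.
by rewrite -val_eqE /= => /negPf ->.
Qed.

Lemma svd_dotV (x : 'cV[R]_n) : dot x x = \sum_(i < n) (V^T *m x) i 0 ^+ 2.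
Proof.
have [[oU oV] _ _ _ _] := svdA.
have <- : dot (V^T *m x) (V^T *m x) = dot x x.
  by rewrite dot_mull trmxK mulmxA mulmx1C // mul1mx.
by apply: eq_bigr => i _; rewrite expr2.
Qed.

Lemma svd_first_orthonormal k : (k <= n)%N ->
  orthonormal_cols (top_cols k V).
Proof.
have [[oU oV] _ _ _ _] := svdA => kn.
rewrite /orthonormal_cols /top_cols trmx_mul mulmxA -(mulmxA _ V^T) oV mulmx1 tr_pid_mx.
by rewrite mul_pid_mx minnn (minn_idPr kn) pid_mx_1.
Qed.

Lemma svd_dot_first k (x : 'cV[R]_n) : (k <= n)%N ->
  dot ((top_cols k V)^T *m x) ((top_cols k V)^T *m x)
  = \sum_(i < n | (i < k)%N) (V^T *m x) i 0 ^+ 2.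
Proof.
move=> kn; rewrite /top_cols trmx_mul tr_pid_mx -mulmxA; set y := V^T *m x.
rewrite (big_ord_narrow kn) /dot; apply: eq_bigr => i _; rewrite -expr2; congr (_ ^+ 2).
rewrite mxE (bigD1 (widen_ord kn i)) //= big1 => [|j ji].
  by rewrite mxE /= eqxx ltn_ord mul1r addr0.
rewrite mxE; case: eqP => [e|]; last by rewrite mul0r.
by case/eqP: ji; apply: val_inj.
Qed.

End WithSvd.

Lemma exists_kernel p q (M : 'M[R]_(p, q)) : (p < q)%N ->
  exists w : 'cV[R]_q, w != 0 /\ M *m w = 0.
Proof.
move=> pq; have : kermx M^T != 0.
  rewrite kermx_eq0 /row_free; apply: contraTneq pq => <-.
  by rewrite -leqNgt mxrank_tr rank_leq_row.
case/rowV0Pn => v vK vn0; exists v^T; split; first by rewrite -trmx0 (inj_eq trmx_inj).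
by apply: trmx_inj; rewrite trmx_mul trmxK trmx0; apply/sub_kermxP.
Qed.

(** One half of Courant-Fischer: some nonzero combination of the [j] columns of [X] is orthogonal to
    the first [j - 1] right singular vectors, and there [B] stretches by at most [sigma B j]. *)
Lemma sigma_ge m n j (B : 'M[R]_(m, n)) (X : 'M[R]_(n, j)) (c : R) :
  (0 < j)%N -> 0 <= c ->
  (forall w : 'cV_j, w != 0 -> X *m w != 0) ->
  (forall w : 'cV_j, c * norm2 (X *m w) <= norm2 (B *m (X *m w))) ->
  c <= sigma B j.
Proof.
case: j X => // j X _ c0 Xinj cX; rewrite /sigma /=.
have [U [V svdB]] := singular_valuesP B; set s := singular_values B in svdB *.
have [w [wn0 wK]] := @exists_kernel _ _ ((pid_mx j : 'M[R]_(j, n)) *m V^T *m X) (ltnSn j).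
set x := X *m w; have xn0 : x != 0 by exact: Xinj.
have y0 (i : 'I_n) : (i < j)%N -> (V^T *m x) i 0 = 0.
  move=> ij; have := congr1 (fun M : 'cV_j => M (Ordinal ij) 0) wK.
  rewrite -!mulmxA -/x; move: (V^T *m x) => y.
  rewrite !mxE (bigD1 i) //= big1 => [|a ai].
    by rewrite mxE /= eqxx ij mul1r addr0.
  rewrite mxE /= eq_sym; case: eqP => [e|]; last by rewrite mul0r.
  by case/eqP: ai; apply: val_inj.
have := cX w; rewrite -/x.
rewrite -ler_sqr ?nnegrE ?mulr_ge0 ?norm2_ge0 // exprMn !sqr_norm2 => H.
rewrite -ler_sqr ?nnegrE ?(svd_ge0 svdB) // -(ler_pM2r (_ : 0 < dot x x)) ?dot_gt0 //.
apply: (le_trans H); rewrite (svd_dot svdB) (svd_dotV svdB) mulr_sumr.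
apply: ler_sum => i _; have [ij|ji] := ltnP i j.
  by rewrite y0 // expr0n !mulr0.
apply: ler_wpM2r; first exact: sqr_ge0.
by rewrite ler_sqr ?nnegrE ?(svd_ge0 svdB) // (svd_decr svdB).
Qed.

(** The other half, with the subspace given by fewer than [j] equations: they have a nonzero
    solution in the span of the first [j] right singular vectors, where [B] stretches by at least
    [sigma B j]. *)
Lemma sigma_le m n q j (B : 'M[R]_(m, n)) (W : 'M[R]_(q, n)) (c : R) :
  (q < j)%N -> (j <= n)%N ->
  (forall x : 'cV_n, W *m x = 0 -> norm2 (B *m x) <= c * norm2 x) ->
  sigma B j <= c.
Proof.
move=> qj jn Wc; have [U [V svdB]] := singular_valuesP B.
rewrite /sigma; set s := singular_values B in svdB *.
set X := top_cols j V.
have oX : orthonormal_cols X by rewrite /X; apply (svd_first_orthonormal svdB jn).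
have [w [wn0 wK]] := exists_kernel (W *m X) qj.
set x := X *m w; have xn0 : 0 < norm2 x by rewrite /x norm2_orthonormal // norm2_gt0.
have := Wc x; rewrite mulmxA => /(_ wK) H.
rewrite -(ler_pM2r xn0); apply: le_trans H.
rewrite -ler_sqr ?nnegrE ?mulr_ge0 ?norm2_ge0 ?(svd_ge0 svdB) // exprMn !sqr_norm2.
have -> : dot x x = dot (X^T *m x) (X^T *m x) by rewrite mulmxA oX mul1mx dot_orthonormal.
rewrite svd_dot_first // (svd_dot svdB) mulr_sumr big_mkcond /=.
apply: ler_sum => i _; case: ifP => ij; last by rewrite mulr_ge0 ?sqr_ge0.
apply: ler_wpM2r; first exact: sqr_ge0.
rewrite ler_sqr ?nnegrE ?(svd_ge0 svdB) // (svd_decr svdB) //.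
by rewrite -ltnS prednK // (leq_ltn_trans _ ij).
Qed.

(** Taking [Q] from a full decomposition gives it exactly [l] columns even when [D] is rank
    deficient; [T] is then singular. Hence the tests need no rank condition. *)
Lemma orthonormal_range m l (D : 'M[R]_(m, l)) : (l <= m)%N ->
  exists (Q : 'M[R]_(m, l)) (T : 'M[R]_l), orthonormal_cols Q /\ D = Q *m T.
Proof.
move=> lm; have [U [s [V svdD]]] := svd_exists D.
have [[oU oV] szs _ _ DE] := svdD.
exists (U *m pid_mx l), (rect_diag l l s *m V^T); split.
  rewrite /orthonormal_cols trmx_mul mulmxA -(mulmxA _ U^T) oU mulmx1 tr_pid_mx.
  by rewrite mul_pid_mx minnn (minn_idPr lm) pid_mx_1.
rewrite {1}DE -!mulmxA; congr (_ *m _); rewrite mulmxA; congr (_ *m _).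
apply/matrixP => i j; rewrite !mxE.
have [il|li] := ltnP i l.
  rewrite (bigD1 (Ordinal il)) //= big1 ?addr0 => [|a ai].
    by rewrite !mxE /= eqxx il mul1r.
  rewrite mxE /= andbC; case: eqP => [e|]; last by rewrite andbF mul0r.
  by case/eqP: ai; apply: val_inj; rewrite /= -e.
rewrite big1 => [|a _]; last by rewrite mxE /= [X in _ && X]ltnNge li andbF mul0r.
by rewrite gtn_eqF // (leq_trans (ltn_ord _) li).
Qed.

End SingularValues.

(** * A finite anti-concentrated family of vectors *)

Lemma count_le1 (T : eqType) (P : pred T) (s : seq T) : uniq s ->
  (forall x y, P x -> P y -> x = y) -> (count P s <= 1)%N.
Proof.
move=> us Px; rewrite -size_filter; have := filter_uniq P us.
have /allP := filter_all P s; case: (seq.filter P s) => [|a [|b r]] //= H.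
rewrite (Px a b) ?H ?inE ?eqxx ?orbT //.
Qed.

Lemma count_iota_le2 (P : pred nat) m n :
  (forall i j k, (i < j < k)%N -> (k < m + n)%N -> ~ [&& P i, P j & P k]) ->
  (count P (iota m n) <= 2)%N.
Proof.
move=> HP; rewrite -size_filter.
have : sorted ltn (seq.filter P (iota m n)).
  by apply: sorted_filter; [exact: ltn_trans|exact: iota_ltn_sorted].
have : all [pred i | P i && (i < m + n)%N] (seq.filter P (iota m n)).
  apply/allP => i; rewrite mem_filter mem_iota => /andP[Pi /andP[_ im]] /=.
  by rewrite Pi im.
case: (seq.filter P (iota m n)) => [|a [|b [|c r]]] //=.
move=> /and4P[/andP[Pa _] /andP[Pb _] /andP[Pc cm] _] /and3P[ab bc _].
by case: (HP a b c); rewrite ?ab ?bc ?Pa ?Pb.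
Qed.

Section Randomizer.
Context {R : realType}.

Lemma sum_indicator (T : Type) (P : pred T) (s : seq T) :
  \sum_(x <- s) (P x)%:R = (count P s)%:R :> R.
Proof. by elim: s => [|x s IH]; rewrite ?big_nil // big_cons IH /= natrD. Qed.

(** All [2^p] sign vectors in a list; averages over the list play the role of expectations over
    independent signs. *)
Fixpoint signs p : seq 'cV[R]_p :=
  if p is p'.+1 then
    [seq (col_mx 1 v : 'cV[R]_(1 + p')) | v <- signs p']
    ++ [seq (col_mx (-1) v : 'cV[R]_(1 + p')) | v <- signs p']
  else [:: 0].

Lemma size_signs_gt0 p : (0 < size (signs p))%N.
Proof. by elim: p => // p IH; rewrite /= size_cat !size_map addn_gt0 IH. Qed.

Lemma signs_entry p v i : v \in signs p -> `|v i 0| <= 1.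
Proof.
elim: p v i => [v []//|p IH] v i /=; rewrite mem_cat => /orP[] /mapP[u us ->];
  rewrite mxE; case: splitP => j _; rewrite ?IH // ord1 !mxE ?normrN normr1 //.
Qed.

(* The fourth moment of a Rademacher sum of vectors is at most three times the
   square of the second one: adding a sign times [a] to [Y] turns [|Y|^2 = u]
   into [u + |a|^2 +- 2 <Y, a>], and Cauchy-Schwarz bounds the square of the
   last term. *)
Lemma signs_moments p q (L : 'M[R]_(q, p)) :
  \sum_(v <- signs p) dot (L *m v) (L *m v) = (size (signs p))%:R * fro2 L /\
  \sum_(v <- signs p) dot (L *m v) (L *m v) ^+ 2 <=
    3 * (size (signs p))%:R * fro2 L ^+ 2.
Proof.
elim: p L => [|p IH] L.
  have -> : L = 0 by apply/matrixP => i [].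
  by rewrite /= !big_seq1 fro20 mul0mx dot0r !expr0n !mulr0.
pose a : 'cV[R]_q := lsubmx (L : 'M[R]_(q, 1 + p)).
pose L' : 'M[R]_(q, p) := rsubmx (L : 'M[R]_(q, 1 + p)).
have LE : L = row_mx a L' :> 'M[R]_(q, 1 + p) by rewrite hsubmxK.
have fE : fro2 L = dot a a + fro2 L'.
  have cl : col (lshift p (0 : 'I_1)) (row_mx a L') = a.
    by apply/matrixP => i j; rewrite mxE row_mxEl !ord1.
  have cr i : col (rshift 1 i) (row_mx a L') = col i L'.
    by apply/matrixP => k l; rewrite mxE row_mxEr [RHS]mxE.
  rewrite !fro2_col LE (@big_split_ord _ _ _ 1 p) big_ord1 /= cl; congr (_ + _).
  by apply: eq_bigr => i _; rewrite cr.
have [m2 m4] := IH L'; rewrite /= !big_cat !big_map /= size_cat !size_map fE natrD.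
have Lp (v : 'cV[R]_p) : L *m (col_mx 1 v : 'cV[R]_(1 + p)) = L' *m v + a.
  by rewrite LE (@mul_row_col _ q 1 p 1) mulmx1 addrC.
have Lm (v : 'cV[R]_p) : L *m (col_mx (-1) v : 'cV[R]_(1 + p)) = L' *m v - a.
  by rewrite LE (@mul_row_col _ q 1 p 1) mulmxN mulmx1 addrC.
set N := (size (signs p))%:R in m2 m4 *.
have sumc (c : R) : \sum_(v <- signs p) c = N * c.
  by rewrite big_const_seq count_predT iter_addr_0 mulr_natl.
split; rewrite -big_split /=.
  rewrite (eq_bigr (fun v => 2 * dot (L' *m v) (L' *m v) + 2 * dot a a)); last first.
    by move=> v _; rewrite Lp Lm !(dotDl, dotDr) !(dotNl, dotNr) (dotC a (L' *m v)); ring.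
  by rewrite big_split /= -!mulr_sumr m2 sumc; ring.
apply: (@le_trans _ _ (\sum_(v <- signs p)
   (2 * dot (L' *m v) (L' *m v) ^+ 2 + 12 * dot a a * dot (L' *m v) (L' *m v) + 2 * dot a a ^+ 2))).
  apply: ler_sum => v _; rewrite Lp Lm !(dotDl, dotDr) !(dotNl, dotNr) (dotC a (L' *m v)).
  have := cauchy_schwarz (L' *m v) a; rewrite !expr2.
  set z := dot _ a; set x := dot (L' *m v) _; set y := dot a a; nra.
rewrite !big_split /= -!mulr_sumr m2 sumc.
have N0 : 0 <= N by rewrite ler0n.
have aa := dot_ge0 a; have ff := fro2_ge0 L'.
have : 0 <= N * (dot a a) ^+ 2 by rewrite mulr_ge0 ?sqr_ge0.
nra.
Qed.

(** Cantelli's one-sided argument: [X = |L v|^2 / |L|_F^2] has mean 1 and second moment at most 3,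
    so [(X - 3)^2] has mean at most 6, whereas it exceeds [(23/8)^2 = 529/64] when [X < 1/8].
    Finally [384/529 < 3/4]. *)
Lemma signs_anticoncentration p q (L : 'M[R]_(q, p)) :
  \sum_(v <- signs p) (dot (L *m v) (L *m v) < fro2 L / 8)%R%:R
    <= 3 / 4 * (size (signs p))%:R :> R.
Proof.
have [f0|fn0] := eqVneq (fro2 L) 0.
  rewrite big1 ?mulr_ge0 // => v _; rewrite f0 mul0r ltNge dot_ge0 //.
have fp : 0 < fro2 L by rewrite lt_neqAle eq_sym fn0 fro2_ge0.
have [m2 m4] := signs_moments L.
set t := fro2 L in fp m2 m4 *; set N := (size (signs p))%:R in m2 m4 *.
pose X v := dot (L *m v) (L *m v) / t.
apply: (@le_trans _ _ (\sum_(v <- signs p) (64 / 529) * (X v - 3) ^+ 2)).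
  apply: ler_sum => v _; case: ltP => [lt|_]; last first.
    by apply: mulr_ge0; [lra|exact: sqr_ge0].
  have : X v < 1 / 8 by rewrite /X ltr_pdivrMr // mulrC mul1r.
  by rewrite /=; nra.
rewrite -mulr_sumr (eq_bigr (fun v => t^-2 * dot (L *m v) (L *m v) ^+ 2
    + ((-6) / t * dot (L *m v) (L *m v) + 9))); last first.
  by move=> v _; rewrite /X; field.
rewrite !big_split /= -!mulr_sumr m2 big_const_seq count_predT iter_addr_0 -mulr_natl -/N.
have -> : -6 / t * (N * t) = -6 * N by field.
have : t^-2 * \sum_(v <- signs p) dot (L *m v) (L *m v) ^+ 2 <= t^-2 * (3 * N * t ^+ 2).
  by rewrite ler_wpM2l // invr_ge0 exprn_ge0 // ltW.
have -> : t^-2 * (3 * N * t ^+ 2) = 3 * N by field.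
have N0 : 0 <= N by rewrite ler0n.
by lra.
Qed.

(** Sums of [b] terms [t s], with [s] ranging over the sign vectors and [t] over 0, ..., 63. A
    further round turns a failure proportion [f] into at most [1/64 + 3/4 f], while the entries are
    at most [64 b] whatever [p] is. *)
Fixpoint randomizer b p : seq 'cV[R]_p :=
  if b is b'.+1 then
    [seq u + z | u <- [seq t%:R *: s | s <- signs p, t <- (iota 0 64)],
                 z <- randomizer b' p]
  else [:: 0].

Lemma randomizerS b p : randomizer b.+1 p =
  [seq u + z | u <- [seq t%:R *: s | s <- signs p, t <- iota 0 64],
               z <- randomizer b p].
Proof. by []. Qed.

Lemma size_randomizer_gt0 b p : (0 < size (randomizer b p))%N.
Proof.
elim: b => // b IH.
by rewrite randomizerS !size_allpairs size_iota !muln_gt0 size_signs_gt0 IH.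
Qed.

Lemma randomizer_entry b p z i : z \in randomizer b p -> `|z i 0| <= 64 * b%:R.
Proof.
elim: b z => [|b IH] z; first by rewrite inE => /eqP ->; rewrite mxE normr0 mulr0.
rewrite randomizerS; case/allpairsP => -[u z'] [/allpairsP[[s t] [ss tt ->]] /IH z'b ->].
have {}tt : (t <= 64)%N by move: tt; rewrite mem_iota => /andP[_ /ltnW].
rewrite !mxE (le_trans (ler_normD _ _)) // -[b.+1]addn1 natrD mulrDr addrC lerD //.
rewrite mulr1 normrM -[leRHS]mulr1 ler_pM ?(signs_entry i ss) //.
by rewrite normr_nat ler_nat.
Qed.

(* If [|L s|] is large for a sign vector [s] then, whatever the offset, at most
   one multiple [t *: s] keeps the sum small; otherwise the earlier terms can
   still make it large. *)
Lemma randomizer_anticoncentration b p q (L : 'M[R]_(q, p)) (y : 'cV[R]_q) :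
  \sum_(z <- randomizer b p)
     (dot (y + L *m z) (y + L *m z) < fro2 L / 32)%R%:R
  <= iter b (fun f => 1 / 64 + 3 / 4 * f) 1 * (size (randomizer b p))%:R :> R.
Proof.
elim: b y => [|b IH] y.
  by rewrite /= big_seq1 mul1r ler_nat; case: (_ < _)%R.
rewrite iterS; set f := iter b _ _ in IH *.
have f0 : 0 <= f by rewrite /f; elim: (b) => //= c c0; lra.
rewrite randomizerS !big_allpairs_dep !size_allpairs size_iota.
set small := fun x : 'cV[R]_q => (dot x x < fro2 L / 32)%R.
set Z := randomizer b p in IH *; set N := (size Z)%:R : R in IH *.
have N0 : 0 <= N by rewrite ler0n.
apply: (@le_trans _ _ (\sum_(s <- signs p)
    (N + (dot (L *m s) (L *m s) < fro2 L / 8)%R%:R * (64 * (f * N))))); last first.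
  rewrite big_split /= -mulr_suml big_const_seq count_predT iter_addr_0 -[N *+ _]mulr_natl.
  have := signs_anticoncentration L; rewrite !natrM -/N.
  set M := (size (signs p))%:R; set S := \sum_(_ <- _) _ => HS.
  have : S * (64 * (f * N)) <= 3 / 4 * M * (64 * (f * N)).
    by rewrite ler_wpM2r // !mulr_ge0.
  lra.
apply: ler_sum => s _; case: ltP => [_|large].
  rewrite mul1r; apply: (@le_trans _ _ (\sum_(t <- (iota 0 64)) f * N)); last first.
    rewrite big_const_seq count_predT size_iota iter_addr_0 -[f * N *+ _]mulr_natl.
    by rewrite lerDr.
  apply: ler_sum => t _.
  apply: le_trans (IH (y + L *m (t%:R *: s))).
  by apply: ler_sum => z _; rewrite mulmxDr addrA.
rewrite mul0r addr0 exchange_big /=.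
apply: (@le_trans _ _ (\sum_(z <- Z) 1)); last first.
  by rewrite big_const_seq count_predT iter_addr_0.
apply: ler_sum => z _.
rewrite (sum_indicator (fun t => small (y + L *m (t%:R *: s + z)))) (ler_nat _ _ 1).
apply: (count_le1 (iota_uniq 0 64)) => t t' st st'; apply/eqP; apply: contraT => tt'.
move: st st'; rewrite /small !mulmxDr !addrA ![y + _ + L *m z]addrAC -!scalemxAr.
set w := y + L *m z; set v := L *m s in large * => st st'; clearbody w v.
(* Two small sums would force [|v|^2 < 4 |L|_F^2 / 32 = |L|_F^2 / 8], against [large]; this fixes
   the ratio between the thresholds 1/32 and 1/8. *)
have D : dot v v <= 2 * dot (w + t%:R *: v) (w + t%:R *: v)
    + 2 * dot (w + t'%:R *: v) (w + t'%:R *: v).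
  have d1 : (1 : R) <= (t%:R - t'%:R) ^+ 2.
    have : (1 <= `|(t%:Z - t'%:Z)|)%R by lia.
    rewrite -(ler_int R) intr_norm rmorphB /= !pmulrn => h.
    by rewrite -real_normK ?num_real // expr_ge1.
  have := dot_ge0 v; have := dot_ge0 (2 *: w + (t%:R + t'%:R) *: v).
  rewrite !(dotDl, dotDr) !(dotZl, dotZr) (dotC v w).
  set a := dot w w; set b' := dot w v; set c := dot v v; set x := t%:R; set x' := t'%:R.
  have : c * 1 <= c * (x - x') ^+ 2 by rewrite ler_wpM2l // dot_ge0.
  nra.
lra.
Qed.

End Randomizer.

(** * Events *)

Section Events.
Context {R : realType}.

Lemma with_prob_ge_sub d (T : measurableType d) (P : probability T R) (p : R)
    (E E' : set T) : E `<=` E' -> with_prob_ge P p E -> with_prob_ge P p E'.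
Proof. by move=> EE' [F [mF FE pF]]; exists F; split => //; exact: subset_trans EE'. Qed.

Lemma with_prob_ge_preimage d d' (Omega : measurableType d) (T : measurableType d')
    (P : probability Omega R) (X : Omega -> T) (mu : probability T R) p E :
  drawn_from P X mu -> with_prob_ge mu p E -> with_prob_ge P p (X @^-1` E).
Proof.
move=> [mX lawX] [F [mF FE pF]]; exists (X @^-1` F); split.
- by rewrite -[X in measurable X]setTI; exact: mX.
- by move=> w /= /FE.
- by rewrite lawX.
Qed.

Lemma probability_ge_setC d (T : measurableType d) (P : probability T R) (a : R) F :
  measurable F -> ((1 - a)%:E <= P F)%E <-> (P (~` F) <= a%:E)%E.
Proof.
move=> mF; rewrite probability_setC //.
have : P F \is a fin_num by rewrite fin_num_measure.
case: (P F) => // r _; rewrite -EFinB !lee_fin; split; lra.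
Qed.

Lemma with_prob_ge_ae d (T : measurableType d) (P : probability T R) (a : R)
    (E : set T) (N : T -> Prop) : with_prob_ge P (1 - a) E ->
  {ae P, forall w, N w} -> with_prob_ge P (1 - a) (E `&` [set w | N w]).
Proof.
move=> [F [mF FE aF]] [M [mM PM0 NM]]; exists (F `&` ~` M); split.
- by apply: measurableI => //; exact: measurableC.
- move=> w [Fw nMw]; split; first exact: FE.
  by apply: contrapT => nNw; apply: nMw; exact: NM.
- apply/probability_ge_setC; first by apply: measurableI => //; exact: measurableC.
  move/probability_ge_setC: aF => /(_ mF) aF.
  rewrite setCI setCK; apply: le_trans (measureU2 _ _ _) _ => //; first exact: measurableC.
  rewrite -[a%:E]adde0; apply: leeD => //.
  by rewrite le_eqVlt; apply/orP; left; apply/eqP; exact: PM0.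
Qed.

Lemma with_prob_geI d (T : measurableType d) (P : probability T R) (a b : R)
    (E E' : set T) : with_prob_ge P (1 - a) E -> with_prob_ge P (1 - b) E' ->
  with_prob_ge P (1 - (a + b)) (E `&` E').
Proof.
move=> [F [mF FE aF]] [F' [mF' FE' bF]]; exists (F `&` F'); split.
- exact: measurableI.
- by apply: setISS.
- apply/probability_ge_setC; first exact: measurableI.
  move/probability_ge_setC: aF => /(_ mF) aF.
  move/probability_ge_setC: bF => /(_ mF') bF.
  rewrite setCI (le_trans (measureU2 _ _ _)) ?EFinD ?leeD //; exact: measurableC.
Qed.

(* Markov's inequality for the number of failed tests. *)
Lemma with_prob_ge_majority d (T : measurableType d) (P : probability T R)
    (I : Type) (s : seq I) (G : I -> set T) (a : R) (E : set T) :
  (0 < size s)%N -> (forall i, with_prob_ge P (1 - a) (G i)) ->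
  (forall x, ~ E x -> (size s <= 2 * count (fun i => `[< ~ G i x >]) s)%N) ->
  with_prob_ge P (1 - 2 * a) E.
Proof.
(* The [G i] need not be measurable, so failures are counted against measurable [F i] inside them,
   which can only overcount. *)
move=> s0 /choice[F HF] sE.
have mF i : measurable (F i) by have [] := HF i.
have FG i : F i `<=` G i by have [] := HF i.
have aF i : (P (~` F i) <= a%:E)%E.
  by have [_ _ /probability_ge_setC] := HF i; apply.
pose g x : R := \sum_(i <- s) \1_(~` F i) x.
have mg : measurable_fun setT g.
  by apply: measurable_sum => i; apply: measurable_indic; exact: measurableC.
pose n : R := (size s)%:R; have n0 : 0 < n by rewrite ltr0n.
pose B := [set x | n <= 2 * g x].
have mB : measurable B.
  rewrite -[B]setTI.
  apply: measurable_fun_le => //; apply: measurable_funM => //.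
exists (~` B); split.
- exact: measurableC.
- move=> x /= nB; apply: contrapT => /sE; apply/negP; rewrite -ltnNge.
  move/negP: nB; rewrite -ltNge /n /g => nB.
  rewrite -(ltr_nat R) natrM; apply: le_lt_trans nB.
  rewrite ler_wpM2l // -sum1_count natr_sum big_mkcond /=.
  apply: ler_sum => i _; case: asboolP => [nG|_]; last by rewrite indicE.
  by rewrite indicE mem_set //= => /FG.
apply/probability_ge_setC; first exact: measurableC.
rewrite setCK.
have : ((n / 2)%:E * P B <= (n * a)%:E)%E.
  apply: (@le_trans _ _ (\int[P]_x (g x)%:E)%E).
    have -> : ((n / 2)%:E * P B = \int[P]_x ((n / 2)%:E * (\1_B x)%:E))%E.
      rewrite ge0_integralZl // ?lee_fin ?divr_ge0 ?(ltW n0) //.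
      - by rewrite integral_indic // setIT.
      - by apply/measurable_EFinP; exact: measurable_indic.
    apply: ge0_le_integral => //.
    - by move=> x _; rewrite mule_ge0 // lee_fin // divr_ge0 // ltW.
    - apply: measurable_funeM; apply/measurable_EFinP; exact: measurable_indic.
    - exact/measurable_EFinP.
    - move=> x _; rewrite -EFinM lee_fin indicE.
      case: (boolP (x \in B)) => [|_]; last by rewrite mulr0; apply: sumr_ge0 => i _.
      by rewrite inE mulr1 /B /= ler_pdivrMr // mulrC.
  rewrite /g (eq_integral (fun x => \sum_(i <- s) (\1_(~` F i) x)%:E)%E); last first.
    by move=> x _; rewrite sumEFin.
  rewrite ge0_integral_sum //; last first.
    by move=> i; apply/measurable_EFinP; apply: measurable_indic; exact: measurableC.
  apply: (@le_trans _ _ (\sum_(i <- s) a%:E)%E).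
    apply: lee_sum => i _; rewrite integral_indic // ?setIT; [exact: aF|exact: measurableC].
  by rewrite sumEFin lee_fin big_const_seq count_predT iter_addr_0 -[a *+ _]mulr_natl.
have : P B \is a fin_num by rewrite fin_num_measure.
case: (P B) => // r _; rewrite -EFinM !lee_fin => H.
rewrite -(ler_pM2l n0); lra.
Qed.

Lemma with_prob_ge_joint d d1 d2 (Omega : measurableType d)
    (T1 : measurableType d1) (T2 : measurableType d2) (P : probability Omega R)
    (X : Omega -> T1) (Y : Omega -> T2) (mu : probability T1 R)
    (nu : probability T2 R) (p : R) (J : set (T2 * T1)) :
  drawn_from P X mu -> drawn_from P Y nu -> independent P X Y ->
  measurable J -> (forall y, with_prob_ge mu p [set x | J (y, x)]) ->
  with_prob_ge P p [set w | J (Y w, X w)].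
Proof.
move=> [mX lawX] [mY lawY] ind mJ Jp.
have [p0|/ltW p0] := leP 0 p; last first.
  by exists set0; split => //; rewrite measure0 lee_fin.
have mYX : measurable_fun setT (fun w => (Y w, X w)) by exact: measurable_fun_pair.
exists ((fun w => (Y w, X w)) @^-1` J); split => //.
  by rewrite -[X in measurable X]setTI; exact: mYX.
(* By independence the law of the pair agrees with the product measure on rectangles, which
   determines it. *)
have -> : P ((fun w => (Y w, X w)) @^-1` J) = (nu \x mu)%E J.
  symmetry; apply: (@product_measure_unique _ _ _ _ _ nu mu
    (pushforward P (fun w => (Y w, X w)))) => // A B mA mB.
  rewrite /pushforward /= -lawX // -lawY // muleC -ind //.
  by congr (P _); apply/seteqP; split => w /= [].
have xs y : (p%:E <= mu (xsection J y))%E.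
  have [F [mF FJ pF]] := Jp y; apply: (le_trans pF); apply: le_measure; rewrite ?inE //.
    exact: measurable_xsection.
  by move=> x /FJ /=; rewrite /xsection /= inE.
rewrite /product_measure1 /=.
have -> : p%:E = (\int[nu]_x (cst p%:E x))%E.
  by rewrite integral_cst //= probability_setT mule1.
apply: ge0_le_integral => //.
exact: measurable_fun_xsection.
Qed.

End Events.

(** * Consequences of the embedding property *)

Section Sketch.
Context {R : realType}.

(** The distortion is relative to [D *m x], so that it makes sense for the tests [Q + t H], whose
    columns are not orthonormal. *)
Definition embeds (eps : R) r N k (S : 'M[R]_(r, N)) (D : 'M[R]_(N, k)) : Prop :=
  forall x : 'cV[R]_k,
    (1 - eps) * norm2 (D *m x) <= norm2 (S *m (D *m x)) <= (1 + eps) * norm2 (D *m x).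

Lemma sigma_min_max r k (M : 'M[R]_(r, k)) (y : 'cV[R]_k) : (k <= r)%N ->
  sigma_min M * norm2 y <= norm2 (M *m y) <= sigma_max M * norm2 y.
Proof.
move=> kr; have [U [V svdM]] := singular_valuesP M.
rewrite /sigma_min /sigma_max /sigma (minn_idPr kr) /=.
set s := singular_values M in svdM *.
have s0 := svd_ge0 svdM; apply/andP; split;
  rewrite -ler_sqr ?nnegrE ?mulr_ge0 ?norm2_ge0 // exprMn !sqr_norm2
    (svd_dot svdM) (svd_dotV svdM) mulr_sumr;
  apply: ler_sum => i _; apply: ler_wpM2r; rewrite ?sqr_ge0 //;
  rewrite ler_sqr ?nnegrE ?s0 // (svd_decr svdM) //.
by rewrite -ltnS prednK // (leq_ltn_trans _ (ltn_ord i)).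
Qed.

Lemma OSE_embeds r N k (eps delta : R) (mu : probability 'M[R]_(r, N) R)
    (D : 'M[R]_(N, k)) : (k <= N)%N -> OSE k eps delta mu ->
  with_prob_ge mu (1 - delta) [set S : 'M[R]_(r, N) | embeds eps S D].
Proof.
move=> kN [kr ose]; have [Q [T [oQ ->]]] := orthonormal_range D kN.
apply: with_prob_ge_sub (ose Q oQ) => S /= [lo _ hi] x.
rewrite -mulmxA norm2_orthonormal //; set y := T *m x; rewrite mulmxA.
have /andP[h1 h2] := sigma_min_max (S *m Q) y kr; apply/andP; split.
  by apply: le_trans h1; rewrite ler_wpM2r ?norm2_ge0.
by apply: le_trans h2 _; rewrite ler_wpM2r ?norm2_ge0.
Qed.

(* With ratio 4, a vector [x] crushed by [S Q] can be compensated by a multiple of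
   [S H x] at one scale at most: see [embeds_lower]. *)
Definition scale (i : nat) : R := 8^-1 / 4 ^+ i.

Lemma scale_gt0 i : 0 < scale i.
Proof. by rewrite divr_gt0 ?exprn_gt0. Qed.

Lemma scale_le i : scale i <= 1 / 8.
Proof. by rewrite /scale ler_pdivrMr ?exprn_gt0 // mul1r ler_peMr // exprn_ege1 // ler1n. Qed.

Lemma scale_decr i j : (i < j)%N -> 4 * scale j <= scale i.
Proof.
move=> ij; rewrite /scale mulrCA ler_wpM2l //.
rewrite -(subnK ij) addnS -addSn exprD exprS invfM mulrA invfM mulrA divff // mul1r.
by rewrite ler_piMl ?invr_ge0 ?exprn_ge0 // invf_le1 ?exprn_gt0 // exprn_ege1 // ler1n.
Qed.

(** Three times the smallest scale [scale 5 = 1 / 8192]: with ratio 4, two distinct scales differ by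
    at least three times the smaller one. *)
Definition gap : R := 3 / 8192.

Lemma gap_bounds : 0 < gap <= 1 / 4.
Proof. by rewrite /gap; apply/andP; split; lra. Qed.

Lemma scale_gap i j : (i < j)%N -> (j < 6)%N -> gap <= scale i - scale j.
Proof.
move=> ij j6; have h := scale_decr ij.
suff : 1 / 8192 <= scale j by rewrite /gap; lra.
apply: (@le_trans _ _ (scale 5)); first by rewrite /scale; lra.
by rewrite /scale ler_wpM2l // lef_pV2 ?posrE ?exprn_gt0 // ler_weXn2l // ler1n.
Qed.

(** Six is the least number of rounds for which [f -> 1/64 + 3/4 f], started at 1, falls below 1/4:
    the value is about 0.229, against 0.285 after five. *)
Definition tests p : seq 'cV[R]_p := randomizer 6 p.

Lemma tests_bounded : exists2 K : R, 0 < K &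
  forall p (z : 'cV[R]_p) i, z \in tests p -> `|z i 0| <= K.
Proof.
exists 384 => [|p z i /(randomizer_entry i)/le_trans]; first by lra.
by apply; lra.
Qed.

Lemma tests_anticoncentration p q (L : 'M[R]_(q, p)) :
  (4 * count (fun z => dot (L *m z) (L *m z) < fro2 L / 32)%R (tests p)
   <= size (tests p))%N.
Proof.
have := randomizer_anticoncentration 6 L 0.
under eq_bigr => z _ do rewrite add0r.
rewrite (sum_indicator (fun z => dot (L *m z) (L *m z) < fro2 L / 32)%R) -/(tests p).
rewrite -(ler_nat R) natrM /= => /le_trans h.
have := ler0n R (size (tests p)); have := h _ (lexx _).
by set a := _%:R; set b := _%:R; lra.
Qed.

(** A good [z] passes at most two of the six scales, hence fails at least four; good vectors being
    at least three quarters of all, at least half of the pairs [(z, i)] fail. *)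
Lemma sketch_majority r N k (eps delta : R) (mu : probability 'M[R]_(r, N) R)
    (Q : 'M[R]_(N, k)) p (H : 'cV[R]_p -> 'M[R]_(N, k)) (E : set 'M[R]_(r, N)) :
  (k <= N)%N -> OSE k eps delta mu ->
  (forall S, ~ E S -> exists good : pred 'cV[R]_p,
     (4 * count (predC good) (tests p) <= size (tests p))%N /\
     forall z, z \in tests p -> good z ->
       forall i1 i2 i3, (i1 < i2)%N -> (i2 < i3)%N -> (i3 < 6)%N ->
       embeds eps S (Q + scale i1 *: H z) ->
       embeds eps S (Q + scale i2 *: H z) ->
       embeds eps S (Q + scale i3 *: H z) -> False) ->
  with_prob_ge mu (1 - 2 * delta) E.
Proof.
move=> kN ose bad.
apply: (with_prob_ge_majority (s := [seq (z, i) | z <- tests p, i <- iota 0 6])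
  (G := fun zi => [set S | embeds eps S (Q + scale zi.2 *: H zi.1)])).
- by rewrite size_allpairs size_iota muln_gt0 size_randomizer_gt0.
- by move=> [z i] /=; exact: OSE_embeds.
move=> S nES; have [good [good4 goodP]] := bad S nES.
rewrite -sum1_count big_mkcond big_allpairs_dep size_allpairs size_iota.
apply: (@leq_trans (2 * \sum_(z <- tests p) 4 * good z)); last first.
  rewrite leq_mul2l big_seq [X in (_ <= X)%N]big_seq; apply/leq_sum => z zt.
  case: (boolP (good z)) => [gz|_] //; rewrite muln1 -big_mkcond /= sum1_count.
  set fail : pred nat := fun i => _.
  have : (count (predC fail) (iota 0 6) <= 2)%N.
    apply: count_iota_le2 => i j l /andP[ij jl] l6 /= /and3P[].
    rewrite /fail => /asboolPn/contrapT h1 /asboolPn/contrapT h2 /asboolPn/contrapT h3.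
    exact (goodP z zt gz i j l ij jl l6 h1 h2 h3).
  move=> f2; rewrite -[X in (_ <= X)%N]/(count fail (iota 0 6)).
  have := count_predC fail (iota 0 6); rewrite size_iota; move: f2; lia.
have -> : (\sum_(z <- tests p) 4 * good z = 4 * count good (tests p))%N.
  by rewrite -big_distrr /= -sum1_count [in RHS]big_mkcond.
have := count_predC good (tests p); lia.
Qed.

(** A perturbation of size at most 1/8 and a distortion below 1/6 combine to [5/6 * 7/8 = 35/48] and
    [7/6 * 9/8 = 21/16]. *)
Lemma embeds_window (eps : R) r N k (S : 'M[R]_(r, N)) (Q H : 'M[R]_(N, k)) (t : R) x :
  0 < eps < 1 / 6 -> orthonormal_cols Q -> (forall x : 'cV_k, norm2 (H *m x) <= norm2 x) ->
  0 <= t <= 1 / 8 -> embeds eps S (Q + t *: H) ->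
  35 / 48 * norm2 x <= norm2 (S *m ((Q + t *: H) *m x)) <= 21 / 16 * norm2 x.
Proof.
move=> /andP[e0 e6] oQ H1 /andP[t0 t8] /(_ x); set y := (Q + t *: H) *m x.
have yE : y = Q *m x + t *: (H *m x) by rewrite /y mulmxDl scalemxAl.
have th : norm2 (t *: (H *m x)) <= 1 / 8 * norm2 x.
  by rewrite norm2Z ger0_norm // ler_pM ?norm2_ge0.
have := ler_norm2D (Q *m x) (t *: (H *m x)).
have := lerB_norm2 (Q *m x) (t *: (H *m x)).
rewrite -yE norm2_orthonormal // => lo hi /andP[h1 h2].
have := norm2_ge0 x; have := norm2_ge0 y.
set Y := norm2 y in lo hi h1 h2 *; set X := norm2 x in lo hi th *; set Z := norm2 _ in h1 h2 *.
move=> Y0 X0; apply/andP; split.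
  apply: (le_trans _ h1); have : 5 / 6 * Y <= (1 - eps) * Y by rewrite ler_wpM2r //; lra.
  lra.
apply: (le_trans h2); have : (1 + eps) * Y <= 7 / 6 * Y by rewrite ler_wpM2r //; lra.
lra.
Qed.

Lemma embeds_lower (eps : R) r N k (S : 'M[R]_(r, N)) (Q H : 'M[R]_(N, k)) i j :
  0 < eps < 1 / 6 -> orthonormal_cols Q -> (forall x : 'cV_k, norm2 (H *m x) <= norm2 x) ->
  (i < j)%N ->
  embeds eps S (Q + scale i *: H) -> embeds eps S (Q + scale j *: H) ->
  forall x, 1 / 4 * norm2 x <= norm2 (S *m (Q *m x)).
Proof.
move=> e6 oQ H1 ij Ei Ej x; rewrite leNgt; apply/negP => small.
have ti n : 0 <= scale n <= 1 / 8 by rewrite ltW ?scale_gt0 ?scale_le.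
have /andP[_ hi] := embeds_window x e6 oQ H1 (ti i) Ei.
have /andP[lo _] := embeds_window x e6 oQ H1 (ti j) Ej.
move: hi lo; rewrite !mulmxDl !mulmxDr -!scalemxAl -!scalemxAr.
set u := S *m (Q *m x) in small *; set v := S *m (H *m x) => hi lo.
(* In units of [|x|]: if [|u| < 1/4], scale [i] gives [scale i |v| < 25/16], hence
   [scale j |v| < 25/64], and [1/4 + 25/64 = 41/64] is below the 35/48 required at scale [j]. *)
have h1 : norm2 (scale i *: v) - norm2 u <= norm2 (u + scale i *: v).
  by rewrite [u + _]addrC lerB_norm2.
have h2 := ler_norm2D u (scale j *: v).
move: h1 h2 hi lo; rewrite !norm2Z !ger0_norm ?(ltW (scale_gt0 _)) //.
have := ler_wpM2r (norm2_ge0 v) (scale_decr ij).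
have := norm2_ge0 x; move: small.
set X := norm2 x; set U := norm2 u; set V := norm2 v; set P := norm2 _; set P' := norm2 _.
rewrite -(mulrA 4); set a := scale i * V; set b := scale j * V. lra.
Qed.

Lemma scale_bounds i : 0 <= scale i <= 1 / 8.
Proof. by rewrite ltW ?scale_gt0 ?scale_le. Qed.

Lemma card_block_le N g j : (0 < g)%N -> (#|[pred i : 'I_N | (i %/ g == j)%N]| <= g)%N.
Proof.
case: g => // g _; rewrite -[X in (_ <= X)%N]card_ord.
set A := [pred i : 'I_N | _].
have fI : {in A &, injective (fun i : 'I_N => inord (i %% g.+1)%N : 'I_g.+1)}.
  move=> a b; rewrite !inE => /eqP aj /eqP bj /(congr1 val); rewrite /= !inordK ?ltn_pmod // => e.
  by apply: val_inj; rewrite /= (divn_eq a g.+1) (divn_eq b g.+1) aj bj e.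
by rewrite -(card_in_image fI); exact: max_card.
Qed.

(* The coordinates are split into [k] blocks of size at most [g]; column [j] is
   the part of [z] living on block [j]. *)
Definition block_mx_of N k (K : R) (g : nat) (z : 'cV[R]_N) : 'M[R]_(N, k) :=
  \matrix_(i, j) (if (i %/ g == j)%N then z i 0 / (K * Num.sqrt g%:R) else 0).

(** The columns have disjoint supports of size at most [g] and entries at most [1 / sqrt g], so they
    are orthogonal and of norm at most 1. *)
Lemma block_mx_contraction N k K g (z : 'cV[R]_N) (x : 'cV[R]_k) :
  (0 < g)%N -> (N <= k * g)%N -> 0 < K -> (forall i, `|z i 0| <= K) ->
  norm2 (block_mx_of k K g z *m x) <= norm2 x.
Proof.
move=> g0 Nk K0 zK; have gr : (0 : R) < g%:R by rewrite ltr0n.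
rewrite -[leRHS]mul1r ler_norm2 // expr1n mul1r.
have lt (i : 'I_N) : (i %/ g < k)%N by rewrite ltn_divLR // (leq_trans (ltn_ord i)).
have E (i : 'I_N) : (block_mx_of k K g z *m x) i 0 =
    z i 0 / (K * Num.sqrt g%:R) * x (Ordinal (lt i)) 0.
  rewrite mxE (bigD1 (Ordinal (lt i))) //= mxE eqxx big1 ?addr0 // => j ji.
  by rewrite mxE; case: eqP => [e|]; rewrite ?mul0r //; case/eqP: ji; apply: val_inj.
rewrite [leLHS]/dot.
apply: (@le_trans _ _ (\sum_(i < N) x (Ordinal (lt i)) 0 ^+ 2 / g%:R)).
  apply: ler_sum => i _; rewrite E -expr2 exprMn [leRHS]mulrC.
  rewrite ler_wpM2r ?sqr_ge0 // expr_div_n exprMn sqr_sqrtr ?(ltW gr) // invfM mulrA.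
  rewrite ler_piMl ?invr_ge0 ?(ltW gr) // ler_pdivrMr ?exprn_gt0 // mul1r.
  by rewrite -real_normK ?num_real // ler_sqr ?nnegrE // ltW.
rewrite (partition_big (fun i => Ordinal (lt i)) xpredT) //= /dot.
apply: ler_sum => j _; rewrite -expr2.
rewrite (eq_bigr (fun=> x j 0 ^+ 2 / g%:R)) => [|i /eqP <- //].
rewrite sumr_const -[_ *+ _]mulr_natr mulrAC ler_pdivrMr // ler_wpM2l ?sqr_ge0 //.
rewrite ler_nat; apply: leq_trans (card_block_le N j g0).
by apply/subset_leq_card/fintype.subsetP => i; rewrite !inE => /eqP <-.
Qed.

(** The norm bound is proved for the transpose. If [v = S^T u] is too long, a passed test bounds
    [Q^T v + t H_z^T v] by [21/16 |u|]; subtracting two scales leaves [|H_z^T v| <= B |u|] with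
    [B = 21/8 / gap]. But [H_z^T v = L z] is linear in [z], with [|L|_F] proportional to [|v|], so
    anti-concentration makes it long for most [z]. *)
Lemma sketch_norm : exists2 C : R, 0 < C &
  forall r N k (eps delta : R) (mu : probability 'M[R]_(r, N) R)
    (Q : 'M[R]_(N, k)), (0 < k <= N)%N -> 0 < eps < 1 / 6 ->
  OSE k eps delta mu -> orthonormal_cols Q ->
  with_prob_ge mu (1 - 2 * delta) [set S : 'M[R]_(r, N) |
    (forall x : 'cV_k, 1 / 4 * norm2 x <= norm2 (S *m (Q *m x))) /\
    (forall y : 'cV_N, norm2 (S *m y) <= C * Num.sqrt (N%:R / k%:R) * norm2 y)].
Proof.
have [K K0 entry] := tests_bounded.
have /andP[gap0 _] := gap_bounds.
have [B B0 BE] : exists2 B : R, 0 < B & B = 21 / 8 / gap.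
  by exists (21 / 8 / gap) => //; rewrite divr_gt0 // divr_gt0.
have C0 : 0 < 8 * B * K by apply: mulr_gt0 => //; apply: mulr_gt0.
exists (8 * B * K) => // r N k eps delta mu Q.
(* With this [g], [k] blocks cover all [N] coordinates, and [k <= N] keeps [g k <= 2 N]. The factor
   2 and the 32 of anti-concentration make up the square of the 8 in the constant. *)
move=> /andP[k0 kN] e6 ose oQ; pose g := (N %/ k)%N.+1.
have Nkg : (N <= k * g)%N by rewrite mulnC ltnW // ltn_ceil.
have kr : (0 : R) < k%:R by rewrite ltr0n.
have gr : (0 : R) < g%:R by rewrite ltr0n.
have g2N : g%:R * k%:R <= 2 * N%:R :> R.
  rewrite -!natrM ler_nat /g mulSn addnC mul2n -addnn leq_add // leq_divM //.
have sNk : 0 <= Num.sqrt (N%:R / k%:R) :> R by exact: sqrtr_ge0.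
apply: (sketch_majority (Q := Q) (H := block_mx_of k K g) kN ose) => S bad.
have H1 z : z \in tests N -> forall x : 'cV_k, norm2 (block_mx_of k K g z *m x) <= norm2 x.
  by move=> zt x; by apply: block_mx_contraction => // i; exact: entry.
have [lo|nlo] := pselect (forall x : 'cV_k, 1 / 4 * norm2 x <= norm2 (S *m (Q *m x))); last first.
  exists xpredT; split.
    by rewrite (@eq_count _ _ pred0) // count_pred0 muln0.
  by move=> z zt _ i1 i2 i3 i12 _ _ E1 E2 _; apply: nlo; exact: embeds_lower e6 oQ (H1 z zt) i12 E1 E2.
have [u nu] : exists u, ~ norm2 (S^T *m u) <= 8 * B * K * Num.sqrt (N%:R / k%:R) * norm2 u.
  apply/existsNP => up; apply: bad; split => // y.
  by rewrite -[S]trmxK; apply: norm2_dual => //; rewrite mulr_ge0 // ltW.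
set v := S^T *m u in nu.
(* The block matrix with [v] in place of [z]: it exchanges the roles of the two vectors in
   [H_z^T v]. *)
pose L : 'M[R]_(k, N) :=
  \matrix_(j, i) (if (i %/ g == j)%N then v i 0 / (K * Num.sqrt g%:R) else 0).
have LE z : (block_mx_of k K g z)^T *m v = L *m z.
  apply/matrixP => a b; rewrite !mxE !ord1; apply: eq_bigr => i _; rewrite !mxE.
  by case: ifP => _; rewrite ?mul0r //; ring.
have Lji j (i : 'I_N) :
    L j i = if (i %/ g == j)%N then v i 0 / (K * Num.sqrt g%:R) else 0 by rewrite mxE.
have fL : fro2 L = dot v v / (K ^+ 2 * g%:R).
  rewrite -fro2_tr /fro2 /dot mulr_suml; apply: eq_bigr => i _.
  have lt : (i %/ g < k)%N by rewrite ltn_divLR // (leq_trans (ltn_ord i)).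
  rewrite (bigD1 (Ordinal lt)) //= mxE Lji eqxx big1 => [|j ji].
    by rewrite addr0 expr_div_n exprMn sqr_sqrtr ?(ltW gr) // expr2.
  rewrite mxE Lji; case: eqP => [e|]; rewrite ?expr0n //.
  by case/eqP: ji; apply: val_inj.
exists (fun z => ~~ (dot (L *m z) (L *m z) < fro2 L / 32)%R); split.
  rewrite (eq_count (a2 := fun z => dot (L *m z) (L *m z) < fro2 L / 32)%R).
    exact: tests_anticoncentration.
  by move=> z /=; rewrite negbK.
move=> z zt; rewrite -leNgt => Lz i1 i2 i3 i12 i23 i3lt E1 E2 _.
apply: nu; have {}i2lt := ltn_trans i23 i3lt.
have dual i : embeds eps S (Q + scale i *: block_mx_of k K g z) ->
    norm2 (Q^T *m v + scale i *: (L *m z)) <= 21 / 16 * norm2 u.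
  move=> Ei; rewrite -LE; set D := Q + _ in Ei.
  have -> : Q^T *m v + scale i *: ((block_mx_of k K g z)^T *m v) = (S *m D)^T *m u.
    by rewrite trmx_mul -mulmxA -/v /D linearD /= linearZ /= mulmxDl -scalemxAl.
  apply: norm2_dual => [|x]; first by lra.
  by rewrite -mulmxA; have /andP[_] := embeds_window x e6 oQ (H1 z zt) (scale_bounds i) Ei.
have := ler_norm2B (Q^T *m v + scale i1 *: (L *m z)) (Q^T *m v + scale i2 *: (L *m z)).
rewrite opprD addrACA subrr add0r -scalerBl norm2Z => H.
have gp := scale_gap i12 i2lt.
have {}H : gap * norm2 (L *m z) <= 21 / 8 * norm2 u.
  apply: (@le_trans _ _ (`|scale i1 - scale i2| * norm2 (L *m z))).
    by rewrite ler_wpM2r ?norm2_ge0 // (le_trans gp) // ler_norm.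
  have := dual _ E1; have := dual _ E2; lra.
have u0 := dot_ge0 u.
have {H} : norm2 (L *m z) <= B * norm2 u.
  by rewrite BE mulrAC ler_pdivlMr // mulrC.
have CN0 : 0 <= 8 * B * K * Num.sqrt (N%:R / k%:R) by apply: mulr_ge0 => //; exact: ltW.
rewrite (ler_norm2 _ _ (ltW B0)) (ler_norm2 _ _ CN0).
rewrite exprMn sqr_sqrtr ?divr_ge0 // => H.
have h1 : dot v v <= 32 * (B ^+ 2 * dot u u) * (K ^+ 2 * g%:R).
  rewrite -ler_pdivrMr ?mulr_gt0 ?exprn_gt0 // -fL; lra.
have h2 : g%:R * dot u u <= 2 * (N%:R / k%:R) * dot u u.
  by rewrite ler_wpM2r // mulrA ler_pdivlMr.
have h3 : 32 * B ^+ 2 * K ^+ 2 * (g%:R * dot u u) <=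
    32 * B ^+ 2 * K ^+ 2 * (2 * (N%:R / k%:R) * dot u u).
  apply: (ler_wpM2l _ h2); apply: mulr_ge0; [apply: mulr_ge0 => //|]; exact: sqr_ge0.
have -> : (8 * B * K) ^+ 2 * (N%:R / k%:R) * dot u u =
    32 * B ^+ 2 * K ^+ 2 * (2 * (N%:R / k%:R) * dot u u) by ring.
apply: le_trans h1 (le_trans _ h3); rewrite le_eqVlt; apply/orP; left; apply/eqP; ring.
Qed.

(** The divided differences [be + (s + t) ga] are at most [2 eta / rho], and the difference of two
    of them bounds [ga] by [2 eta / rho ^+ 2]. Since [t1 + t2 <= 1/4] and [rho <= 1/4], each of the
    two contributions to [be] is at most half of the final bound. *)
Lemma quadratic_linear_coef (al be ga eta rho t1 t2 t3 : R) :
  0 < rho <= 1 / 4 -> 0 <= t3 -> t1 <= 1 / 8 -> rho <= t1 - t2 -> rho <= t2 - t3 ->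
  `|al + t1 * be + t1 ^+ 2 * ga| <= eta ->
  `|al + t2 * be + t2 ^+ 2 * ga| <= eta ->
  `|al + t3 * be + t3 ^+ 2 * ga| <= eta ->
  `|be| <= eta / rho ^+ 2.
Proof.
move=> /andP[r0 r4] t30 t18 r12 r23 h1 h2 h3.
have eta0 : 0 <= eta := le_trans (normr_ge0 _) h1.
have D (s t : R) : rho <= s - t -> `|al + s * be + s ^+ 2 * ga| <= eta ->
    `|al + t * be + t ^+ 2 * ga| <= eta -> `|be + (s + t) * ga| <= 2 * eta / rho.
  move=> st hs ht; rewrite ler_pdivlMr //.
  apply: (@le_trans _ _ (`|be + (s + t) * ga| * `|s - t|)).
    by rewrite ler_wpM2l // (le_trans st) // ler_norm.
  rewrite -normrM (_ : (be + _) * _ = (al + s * be + s ^+ 2 * ga) - (al + t * be + t ^+ 2 * ga)); last by ring.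
  by rewrite (le_trans (ler_normB _ _)) //; lra.
have d12 := D _ _ r12 h1 h2; have d23 := D _ _ r23 h2 h3.
have gb : `|ga| <= 2 * eta / rho ^+ 2.
  have : `|ga| * (2 * rho) <= 4 * eta / rho.
    apply: (@le_trans _ _ (`|ga| * `|t1 - t3|)).
      by rewrite ler_wpM2l // (le_trans _ (ler_norm _)) //; lra.
    rewrite -normrM (_ : ga * _ = (be + (t1 + t2) * ga) - (be + (t2 + t3) * ga)); last by ring.
    by rewrite (le_trans (ler_normB _ _)) //; lra.
  rewrite -ler_pdivlMr ?mulr_gt0 // => /le_trans; apply.
  rewrite (_ : _ / _ / _ = 2 * eta / rho ^+ 2) //; field; lra.
have -> : be = (be + (t1 + t2) * ga) - (t1 + t2) * ga by ring.
apply: (le_trans (ler_normB _ _)); rewrite normrM.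
have : `|t1 + t2| * `|ga| <= 1 / 4 * (2 * eta / rho ^+ 2).
  by apply: ler_pM => //; rewrite ger0_norm; lra.
have : 2 * eta / rho <= 1 / 2 * (eta / rho ^+ 2).
  rewrite (_ : 2 * eta / rho = 2 * rho * (eta / rho ^+ 2)); last by field; lra.
  rewrite ler_wpM2r ?divr_ge0 ?sqr_ge0 //; lra.
move: d12; rewrite -[2 * eta / rho ^+ 2]mulrA; set w := eta / rho ^+ 2; lra.
Qed.

(* Comparing three scales isolates the cross term [<S Q x, S z>] of the squared
   norm of [S (Q x + t x_0 z)]; evaluating it at [x = |a| e_0 +- a] bounds [a]. *)
Lemma embeds_cross r N k (eps : R) (S : 'M[R]_(r, N)) (Q : 'M[R]_(N, k.+1))
    (z : 'cV[R]_N) i1 i2 i3 :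
  0 < eps < 1 / 6 -> orthonormal_cols Q -> Q^T *m z = 0 -> norm2 z <= 1 ->
  (i1 < i2)%N -> (i2 < i3)%N -> (i3 < 6)%N ->
  let H := z *m (delta_mx 0 0 : 'rV[R]_k.+1) in
  embeds eps S (Q + scale i1 *: H) -> embeds eps S (Q + scale i2 *: H) ->
  embeds eps S (Q + scale i3 *: H) ->
  norm2 (Q^T *m S^T *m S *m z) <= 12 * eps / gap ^+ 2.
Proof.
move=> /andP[e0 e6] oQ Qz z1 i12 i23 i3lt H E1 E2 E3.
set a := Q^T *m S^T *m S *m z.
have Hx (x : 'cV_k.+1) : H *m x = x 0 0 *: z.
  rewrite /H -mulmxA (_ : delta_mx 0 0 *m x = (x 0 0)%:M) ?mul_mx_scalar //.
  by rewrite -rowE; apply/matrixP => i j; rewrite !mxE !ord1 eqxx mulr1n.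
have Qzx (x : 'cV_k.+1) : dot (Q *m x) z = 0.
  by rewrite dot_mull Qz dot0r.
have Dx (t : R) (x : 'cV_k.+1) : (Q + t *: H) *m x = Q *m x + (t * x 0 0) *: z.
  by rewrite mulmxDl -scalemxAl Hx scalerA.
have [->|an0] := eqVneq a 0.
  by rewrite norm2_0 divr_ge0 ?sqr_ge0 ?mulr_ge0 // ltW.
set n := norm2 a; have n0 : 0 < n by rewrite norm2_gt0.
(* The sign prevents cancellation in the first coordinate: both [x 0 0 >= n] and [|<x, a>| >= n^2]
   hold for the [x] below, so the linear coefficient [be] is at least [2 n^3] in absolute value. *)
pose sg : R := if 0 <= a 0 0 then 1 else -1.
have sg2 : sg * sg = 1 by rewrite /sg; case: ifP => _; ring.
have sga : 0 <= sg * a 0 0 by rewrite /sg; case: (leP 0 (a 0 0)) => h; lra.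
pose x : 'cV[R]_k.+1 := n *: delta_mx 0 0 + sg *: a.
have x00 : x 0 0 = n + sg * a 0 0 by rewrite !mxE eqxx mulr1.
have dd : dot (delta_mx 0 0 : 'cV[R]_k.+1) a = a 0 0.
  by rewrite dotE trmx_delta -rowE mxE.
have d1 : dot (delta_mx 0 0 : 'cV[R]_k.+1) (delta_mx 0 0) = 1.
  by rewrite dotE trmx_delta -rowE !mxE eqxx.
have aa : dot a a = n ^+ 2 by rewrite sqr_norm2.
have xa : dot x a = sg * (n * (sg * a 0 0) + n ^+ 2).
  rewrite /x dotDl !dotZl dd aa mulrDr; congr (_ + _).
  by transitivity (sg * sg * (n * a 0 0)); [rewrite sg2 mul1r|ring].
have a0n : sg * a 0 0 <= n.
  have : `|a 0 0| <= n.
    rewrite -ler_sqr ?nnegrE ?norm2_ge0 // real_normK ?num_real // sqr_norm2.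
    rewrite /dot (bigD1 0) //= expr2 lerDl; apply: sumr_ge0 => i _.
    by rewrite -expr2 sqr_ge0.
  by move=> h; apply: le_trans h; rewrite /sg; case: ifP => _; rewrite ?mul1r ?mulN1r ?ler_norm // -normrN ler_norm.
have xx : dot x x <= 4 * n ^+ 2.
  have -> : dot x x = 2 * n ^+ 2 + 2 * n * (sg * a 0 0).
    rewrite /x !(dotDl, dotDr) !(dotZl, dotZr) d1 (dotC a) dd aa.
    transitivity (n ^+ 2 + 2 * n * (sg * a 0 0) + sg * sg * n ^+ 2); first by ring.
    by rewrite sg2; ring.
  have : n * (sg * a 0 0) <= n * n by rewrite ler_wpM2l // ltW.
  by rewrite -mulrA expr2; set p := n * (sg * _); set q := n * n; lra.
clearbody x.
pose al := dot (S *m (Q *m x)) (S *m (Q *m x)) - dot x x.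
pose be := 2 * (x 0 0 * dot x a).
pose ga := x 0 0 ^+ 2 * (dot (S *m z) (S *m z) - dot z z).
(* As [z] is orthogonal to the range of [Q], [|y|^2] has no term linear in [t], so [be] comes from
   [S] alone. The 24 is [3 * 8], from [(1 + eps)^2 - 1 <= 3 eps] and [|y|^2 <= 8 n^2]. *)
have F i : embeds eps S (Q + scale i *: H) ->
    `|al + scale i * be + scale i ^+ 2 * ga| <= 24 * eps * n ^+ 2.
  move=> /(_ x); rewrite Dx; set t := scale i; set y := Q *m x + _.
  have yy : dot y y = dot x x + t ^+ 2 * (x 0 0 ^+ 2 * dot z z).
    rewrite /y !(dotDl, dotDr) !(dotZl, dotZr) (dotC z (Q *m x)) Qzx dot_orthonormal //.
    ring.
  have SS : dot (S *m y) (S *m y) = dot (S *m (Q *m x)) (S *m (Q *m x)) + t * be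
     + t ^+ 2 * (x 0 0 ^+ 2 * dot (S *m z) (S *m z)).
    have xa' : dot x a = dot (S *m (Q *m x)) (S *m z).
      by rewrite !dot_mull /a !mulmxA.
    rewrite /y mulmxDr -scalemxAr !(dotDl, dotDr) !(dotZl, dotZr) (dotC (S *m z) (S *m (Q *m x))).
    rewrite /be xa'; ring.
  have -> : al + t * be + t ^+ 2 * ga = dot (S *m y) (S *m y) - dot y y.
    rewrite yy SS /al /ga; ring.
  have y2 : dot y y <= 8 * n ^+ 2.
    have : t ^+ 2 * (x 0 0 ^+ 2 * dot z z) <= 1 / 64 * dot x x.
      have zz : dot z z <= 1 by rewrite -sqr_norm2 expr_le1 ?norm2_ge0.
      have xx0 : x 0 0 ^+ 2 <= dot x x.
        rewrite /dot (bigD1 0) //= expr2 lerDl; apply: sumr_ge0 => j _.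
        by rewrite -expr2 sqr_ge0.
      have t2 : t ^+ 2 <= 1 / 64.
        have /andP[t0 t8] := scale_bounds i.
        rewrite (_ : 1 / 64 = (1 / 8) ^+ 2 :> R); last by field.
        by rewrite ler_sqr ?nnegrE //; lra.
      have xz : x 0 0 ^+ 2 * dot z z <= dot x x.
        by apply: le_trans xx0; rewrite ler_piMr ?sqr_ge0.
      apply: ler_pM t2 xz; first exact: sqr_ge0.
      by rewrite mulr_ge0 ?sqr_ge0 ?dot_ge0.
    have := sqr_ge0 n; rewrite yy; lra.
  move=> /andP[lo hi]; have y0 := norm2_ge0 y.
  have hi2 : dot (S *m y) (S *m y) <= (1 + eps) ^+ 2 * dot y y.
    by rewrite -ler_norm2 //; lra.
  have lo2 : (1 - eps) ^+ 2 * dot y y <= dot (S *m y) (S *m y).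
    rewrite -!sqr_norm2 -exprMn ler_sqr ?nnegrE ?mulr_ge0 ?norm2_ge0 //; lra.
  have yp := dot_ge0 y.
  have ey : eps * dot y y <= eps * (8 * n ^+ 2) by rewrite ler_wpM2l // ltW.
  have eey : eps ^+ 2 * dot y y <= eps * dot y y.
    by rewrite ler_wpM2r // expr2 ler_piMl ?ltW //; lra.
  have eey0 : 0 <= eps ^+ 2 * dot y y by rewrite mulr_ge0 ?sqr_ge0.
  have e1 : (1 + eps) ^+ 2 * dot y y = dot y y + 2 * (eps * dot y y) + eps ^+ 2 * dot y y by ring.
  have e2 : (1 - eps) ^+ 2 * dot y y = dot y y - 2 * (eps * dot y y) + eps ^+ 2 * dot y y by ring.
  have e3 : 24 * eps * n ^+ 2 = 3 * (eps * (8 * n ^+ 2)) by ring.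
  by rewrite e3 ler_norml; apply/andP; split; lra.
have i2lt := ltn_trans i23 i3lt.
have gap0 := gap_bounds.
have /andP[gp _] := gap0.
have /andP[t30 _] := scale_bounds i3; have /andP[_ t18] := scale_bounds i1.
have := quadratic_linear_coef gap0 t30 t18 (scale_gap i12 i2lt) (scale_gap i23 i3lt)
  (F _ E1) (F _ E2) (F _ E3).
have beE : `|be| = 2 * ((n + sg * a 0 0) * (n * (sg * a 0 0) + n ^+ 2)).
  have h1 : 0 <= n + sg * a 0 0 by rewrite addr_ge0 // ltW.
  have h2 : 0 <= n * (sg * a 0 0) + n ^+ 2.
    by apply: addr_ge0; [apply: mulr_ge0 => //; exact: ltW|exact: sqr_ge0].
  have sg1 : `|sg| = 1 by rewrite /sg; case: ifP; rewrite ?normrN normr1.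
  by rewrite /be x00 xa !normrM sg1 mul1r (ger0_norm h1) (ger0_norm h2) ger0_norm.
rewrite beE ler_pdivlMr ?exprn_gt0 // => h.
rewrite ler_pdivlMr ?exprn_gt0 // -(ler_pM2l (_ : 0 < 2 * n ^+ 2)); last first.
  by rewrite mulr_gt0 // exprn_gt0.
have low : n ^+ 3 <= (n + sg * a 0 0) * (n * (sg * a 0 0) + n ^+ 2).
  rewrite exprS; apply: ler_pM; rewrite ?sqr_ge0 ?(ltW n0) ?lerDl ?lerDr // mulr_ge0 // ltW //.
have : n ^+ 3 * gap ^+ 2 <= (n + sg * a 0 0) * (n * (sg * a 0 0) + n ^+ 2) * gap ^+ 2.
  by rewrite ler_wpM2r ?sqr_ge0.
have -> : 2 * n ^+ 2 * (n * gap ^+ 2) = 2 * (n ^+ 3 * gap ^+ 2) by ring.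
have -> : 2 * n ^+ 2 * (12 * eps) = 24 * eps * n ^+ 2 by ring.
by move: h; rewrite -(mulrA 2); lra.
Qed.

Lemma fro2_mulr_orthonormal m n (A : 'M[R]_(m, n)) (W : 'M[R]_n) :
  orthonormal_cols W -> fro2 (A *m W) = fro2 A.
Proof.
move=> oW; rewrite -fro2_tr trmx_mul fro2_orthonormal ?fro2_tr //.
by rewrite /orthonormal_cols trmxK mulmx1C.
Qed.

Lemma svd_fro2 m n (A : 'M[R]_(m, n)) U s V :
  is_svd A U s V -> fro2 A = \sum_(i < n) s`_i ^+ 2.
Proof.
move=> svdA; have [[oU oV] _ _ _ _] := svdA.
rewrite -(fro2_mulr_orthonormal A oV) fro2_col; apply: eq_bigr => j _.
rewrite col_mul (svd_dot svdA) (bigD1 j) //= big1 => [|i ij].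
  by rewrite colE mulmxA oV mul1mx mxE !eqxx expr1n mulr1 addr0.
by rewrite colE mulmxA oV mul1mx mxE (negPf ij) expr0n mulr0.
Qed.

(** Only the first column of [Q] is perturbed, by a multiple [c] of [G W z]. Three passed scales
    bound [c Q^T S^T S G W z] by [B eps], whereas this vector is [c L z] with
    [|L|_F = |Q^T S^T S G|_F], long for most [z] if the Frobenius bound fails. *)
Lemma sketch_mult : exists2 C : R, 0 < C &
  forall r N k p (eps delta : R) (mu : probability 'M[R]_(r, N) R)
    (Q : 'M[R]_(N, k)) (G : 'M[R]_(N, p)), (0 < k <= N)%N -> 0 < eps < 1 / 6 ->
  OSE k eps delta mu -> orthonormal_cols Q -> Q^T *m G = 0 ->
  with_prob_ge mu (1 - 2 * delta) [set S : 'M[R]_(r, N) |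
    (forall x : 'cV_k, 1 / 4 * norm2 x <= norm2 (S *m (Q *m x))) /\
    fro2 (Q^T *m S^T *m S *m G) <= C * eps * fro2 G].
Proof.
have [K K0 entry] := tests_bounded.
have /andP[gap0 _] := gap_bounds.
have [B B0 BE] : exists2 B : R, 0 < B & B = 12 / gap ^+ 2.
  by exists (12 / gap ^+ 2) => //; rewrite divr_gt0 // exprn_gt0.
have C0 : 0 < 32 * K ^+ 2 * B ^+ 2.
  by apply: mulr_gt0; [apply: mulr_gt0 => //|]; exact: exprn_gt0.
exists (32 * K ^+ 2 * B ^+ 2) => // r N k p eps delta mu Q G.
case: k Q => // k Q /andP[k0 kN] e6 ose oQ QG.
have /andP[e0 e16] := e6.
have [U [s [W svdG]]] := svd_exists G; have [[oU oW] _ _ _ _] := svdG.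
(* In the basis [W], [|G W z|^2] is the sum of [s_i^2 z_i^2], so entries bounded by [K] give
   [|G W z| <= K |G|_F] without a factor depending on [p]. When [G = 0] the inverse is 0 and
   [v z = 0]. *)
pose c := (K * Num.sqrt (fro2 G))^-1; pose v (z : 'cV[R]_p) := c *: (G *m (W *m z)).
pose H (z : 'cV[R]_p) := v z *m (delta_mx 0 0 : 'rV[R]_k.+1).
have GWz (z : 'cV[R]_p) : z \in tests p -> dot (G *m (W *m z)) (G *m (W *m z)) <= K ^+ 2 * fro2 G.
  move=> zt; rewrite (svd_dot svdG) (svd_fro2 svdG) mulr_sumr; apply: ler_sum => i _.
  rewrite mulmxA oW mul1mx mulrC ler_wpM2r ?sqr_ge0 //.
  rewrite -real_normK ?num_real // ler_sqr ?nnegrE ?(ltW K0) //; exact: entry.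
have c2 : c ^+ 2 = (K ^+ 2 * fro2 G)^-1.
  by rewrite /c exprVn exprMn sqr_sqrtr // fro2_ge0.
have v1 z : z \in tests p -> norm2 (v z) <= 1.
  move=> zt; rewrite -(@expr_le1 _ 2) ?norm2_ge0 // sqr_norm2 /v dotZl dotZr mulrA -expr2 c2.
  have [->|fn0] := eqVneq (fro2 G) 0; first by rewrite mulr0 invr0 mul0r.
  have fp : 0 < K ^+ 2 * fro2 G.
    by rewrite mulr_gt0 ?exprn_gt0 // lt_neqAle eq_sym fn0 fro2_ge0.
  by rewrite mulrC ler_pdivrMr // mul1r GWz.
have H1 z : z \in tests p -> forall x : 'cV_k.+1, norm2 (H z *m x) <= norm2 x.
  move=> zt x; rewrite /H -mulmxA (_ : delta_mx 0 0 *m x = (x 0 0)%:M); last first.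
    by rewrite -rowE; apply/matrixP => i j; rewrite !mxE !ord1 eqxx mulr1n.
  rewrite mul_mx_scalar norm2Z -[leRHS]mulr1; apply: ler_pM; rewrite ?norm2_ge0 ?v1 //.
  rewrite -ler_sqr ?nnegrE ?norm2_ge0 // real_normK ?num_real // sqr_norm2.
  rewrite /dot (bigD1 0) //= expr2 lerDl; apply: sumr_ge0 => i _.
  by rewrite -expr2 sqr_ge0.
apply: (sketch_majority (Q := Q) (H := H) kN ose) => S bad.
have [lo|nlo] := pselect (forall x : 'cV_k.+1, 1 / 4 * norm2 x <= norm2 (S *m (Q *m x))); last first.
  exists xpredT; split.
    by rewrite (@eq_count _ _ pred0) // count_pred0 muln0.
  by move=> z zt _ i1 i2 i3 i12 _ _ E1 E2 _; apply: nlo; exact: embeds_lower e6 oQ (H1 z zt) i12 E1 E2.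
have {bad} : 32 * K ^+ 2 * B ^+ 2 * eps * fro2 G < fro2 (Q^T *m S^T *m S *m G).
  by rewrite ltNge; apply/negP => h; apply: bad.
pose L := Q^T *m S^T *m S *m G *m W.
have -> : fro2 (Q^T *m S^T *m S *m G) = fro2 L by rewrite fro2_mulr_orthonormal.
move=> big.
have fp : 0 < fro2 G.
  rewrite lt_neqAle fro2_ge0 andbT; apply/eqP => f0.
  move: big; rewrite -f0 mulr0 /L (fro2_eq0 (esym f0)) mulmx0 mul0mx fro20 ltxx //.
exists (fun z => ~~ (dot (L *m z) (L *m z) < fro2 L / 32)%R); split.
  rewrite (eq_count (a2 := fun z => dot (L *m z) (L *m z) < fro2 L / 32)%R).
    exact: tests_anticoncentration.
  by move=> z /=; rewrite negbK.
move=> z zt; rewrite -leNgt => Lz i1 i2 i3 i12 i23 i3lt E1 E2 E3.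
have Qv : Q^T *m v z = 0 by rewrite /v -scalemxAr (mulmxA Q^T) QG mul0mx scaler0.
have := embeds_cross e6 oQ Qv (v1 z zt) i12 i23 i3lt E1 E2 E3.
have -> : Q^T *m S^T *m S *m v z = c *: (L *m z).
  by rewrite /v -scalemxAr /L !mulmxA.
have -> : 12 * eps / gap ^+ 2 = B * eps by rewrite BE mulrAC.
rewrite -ler_sqr ?nnegrE ?norm2_ge0 ?mulr_ge0 ?(ltW B0) ?(ltW e0) // sqr_norm2.
rewrite dotZl dotZr mulrA -expr2 c2 mulrC ler_pdivrMr; last first.
  by rewrite mulr_gt0 // exprn_gt0.
have eps2 : eps ^+ 2 <= eps by rewrite expr2 ler_piMl ?(ltW e0) //; lra.
have : (B * eps) ^+ 2 * (K ^+ 2 * fro2 G) <= B ^+ 2 * eps * (K ^+ 2 * fro2 G).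
  rewrite exprMn; apply: ler_wpM2r; first by rewrite mulr_ge0 ?sqr_ge0 ?fro2_ge0.
  by apply: ler_wpM2l => //; exact: sqr_ge0.
have e : 32 * K ^+ 2 * B ^+ 2 * eps * fro2 G = 32 * (B ^+ 2 * eps * (K ^+ 2 * fro2 G)) by ring.
rewrite e in big; move=> h1 h2; lra.
Qed.

End Sketch.

(** * Measurability *)

Section Measurability.
Context {R : realType}.

Lemma measurable_forall d (T : measurableType d) (I : countType) (P : I -> T -> Prop) :
  (forall i, measurable [set w | P i w]) -> measurable [set w | forall i, P i w].
Proof.
move=> mP; pose F n := if unpickle n is Some i then [set w | P i w] else setT.
rewrite (_ : [set w | _] = \bigcap_n F n); last first.
  apply/seteqP; split => w /= Pw; first by move=> n _; rewrite /F; case: unpickle.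
  by move=> i; have := Pw (pickle i) Logic.I; rewrite /F pickleK.
by apply: bigcapT_measurable => n; rewrite /F; case: unpickle => // i.
Qed.

Definition measurable_mx d (T : measurableType d) m n (X : T -> 'M[R]_(m, n)) : Prop :=
  forall i j, measurable_fun setT (fun w => X w i j).

Lemma measurable_mxP d (T : measurableType d) m n (X : T -> 'M[R]_(m, n)) :
  measurable_mx X <-> measurable_fun setT X.
Proof.
split=> mX; last first.
  move=> i j _ B mB; rewrite setTI.
  have mS : measurable [set M : 'M[R]_(m, n) | B (M i j)].
    by apply: sub_sigma_algebra; exists i, j, B.
  by have := mX measurableT _ mS; rewrite setTI.
apply (@measurability _ _ T ('M[R]_(m, n)) setT X (@mx_entry_preimages R m n)) => //.
by move=> _ [_ [i [j [B [mB ->]]]] <-]; exact: mX.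
Qed.

Section Operations.
Context d (T : measurableType d).

Lemma measurable_mx_cst m n (A : 'M[R]_(m, n)) : measurable_mx (fun _ : T => A).
Proof. by move=> i j; exact: measurable_cst. Qed.

Lemma measurable_mx_tr m n (X : T -> 'M[R]_(m, n)) :
  measurable_mx X -> measurable_mx (fun w => (X w)^T).
Proof. by move=> mX i j; under eq_fun do rewrite mxE; exact: mX. Qed.

Lemma measurable_mxM m n p (X : T -> 'M[R]_(m, n)) (Y : T -> 'M[R]_(n, p)) :
  measurable_mx X -> measurable_mx Y -> measurable_mx (fun w => X w *m Y w).
Proof.
move=> mX mY i j; under eq_fun do rewrite mxE.
by apply: measurable_sum => k; apply: measurable_funM.
Qed.

Lemma measurable_mxB m n (X Y : T -> 'M[R]_(m, n)) :
  measurable_mx X -> measurable_mx Y -> measurable_mx (fun w => X w - Y w).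
Proof.
move=> mX mY i j; under eq_fun do rewrite !mxE.
exact: measurable_funB.
Qed.

Lemma measurable_mxZ m n (f : T -> R) (X : T -> 'M[R]_(m, n)) :
  measurable_fun setT f -> measurable_mx X -> measurable_mx (fun w => f w *: X w).
Proof.
move=> mf mX i j; under eq_fun do rewrite mxE.
exact: measurable_funM.
Qed.

Lemma measurable_det n (X : T -> 'M[R]_n) :
  measurable_mx X -> measurable_fun setT (fun w => \det (X w)).
Proof.
move=> mX; apply: measurable_sum => s; apply: measurable_funM => //.
by apply: measurable_prod => i _.
Qed.

Lemma measurable_adj n (X : T -> 'M[R]_n) :
  measurable_mx X -> measurable_mx (fun w => \adj (X w)).
Proof.
move=> mX i j; under eq_fun do rewrite mxE /cofactor.
apply: measurable_funM => //; apply: measurable_det => a b.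
by under eq_fun do rewrite !mxE; exact: mX.
Qed.

Lemma measurable_dot n (X Y : T -> 'cV[R]_n) :
  measurable_mx X -> measurable_mx Y -> measurable_fun setT (fun w => dot (X w) (Y w)).
Proof. by move=> mX mY; apply: measurable_sum => i; apply: measurable_funM. Qed.

Lemma measurable_fro2 m n (X : T -> 'M[R]_(m, n)) :
  measurable_mx X -> measurable_fun setT (fun w => fro2 (X w)).
Proof.
move=> mX; apply: measurable_sum => i; apply: measurable_sum => j.
exact: measurable_funX.
Qed.

Lemma measurable_set_le (f g : T -> R) : measurable_fun setT f ->
  measurable_fun setT g -> measurable [set w | f w <= g w].
Proof. by move=> mf mg; rewrite -[X in measurable X]setTI; exact: measurable_fun_le. Qed.

(* Domination between two quadratic forms has to be tested on integer vectors
   only, which is why it is a measurable condition. *)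
Lemma int_dominated p q n (A : 'M[R]_(p, n)) (B : 'M[R]_(q, n)) :
  (forall x : 'cV[int]_n, dot (A *m map_mx intr x) (A *m map_mx intr x) <=
                          dot (B *m map_mx intr x) (B *m map_mx intr x)) ->
  forall x : 'cV[R]_n, dot (A *m x) (A *m x) <= dot (B *m x) (B *m x).
Proof.
move=> H x.
have Hn (z : 'cV[int]_n) : norm2 (A *m map_mx intr z) <= norm2 (B *m map_mx intr z).
  by rewrite -[leRHS]mul1r ler_norm2 // expr1n mul1r.
pose bound r (M : 'M[R]_(r, n)) := Num.sqrt (\sum_i (\sum_j `|M i j|) ^+ 2).
have boundP r (M : 'M[R]_(r, n)) (e : 'cV[R]_n) : (forall j, `|e j 0| <= 1) ->
    norm2 (M *m e) <= bound r M.
  move=> e1; rewrite norm2E /bound ler_wsqrtr //; apply: ler_sum => i _.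
  rewrite -expr2 -real_normK ?num_real // ler_sqr ?nnegrE ?sumr_ge0 // mxE.
  apply: (le_trans (ler_norm_sum _ _ _)); apply: ler_sum => j _.
  by rewrite normrM ler_piMr.
suff : norm2 (A *m x) <= norm2 (B *m x).
  by rewrite -[leRHS]mul1r ler_norm2 // expr1n mul1r.
rewrite leNgt; apply/negP => lt.
set K := bound _ A + bound _ B.
(* [N.+1] times the presumed gap exceeds [K], whereas rounding [N.+1 *: x] to an integer vector
   moves the two norms by at most [K] in total. *)
pose N := Num.truncn (K / (norm2 (A *m x) - norm2 (B *m x))).
have dp : 0 < norm2 (A *m x) - norm2 (B *m x) by rewrite subr_gt0.
have K0 : 0 <= K by rewrite addr_ge0 ?sqrtr_ge0.
have : K < N.+1%:R * (norm2 (A *m x) - norm2 (B *m x)).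
  by rewrite -ltr_pdivrMr // truncnS_gt.
apply/negP; rewrite -leNgt.
pose z : 'cV[int]_n := \col_j Num.floor (N.+1%:R * x j 0).
pose e := N.+1%:R *: x - map_mx intr z.
have e1 j : `|e j 0| <= 1.
  rewrite !mxE; have /andP[] := floor_itv (N.+1%:R * x j 0).
  rewrite intrD => h1 h2; rewrite ger0_norm; lra.
have xE : N.+1%:R *: x = map_mx intr z + e by rewrite /e addrC subrK.
have hA : N.+1%:R * norm2 (A *m x) <= norm2 (A *m map_mx intr z) + bound _ A.
  have -> : N.+1%:R * norm2 (A *m x) = norm2 (A *m (N.+1%:R *: x)).
    by rewrite -scalemxAr norm2Z normr_nat.
  by rewrite xE mulmxDr (le_trans (ler_norm2D _ _)) // lerD2l boundP.
have hB : norm2 (B *m map_mx intr z) <= N.+1%:R * norm2 (B *m x) + bound _ B.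
  have -> : N.+1%:R * norm2 (B *m x) = norm2 (B *m (N.+1%:R *: x)).
    by rewrite -scalemxAr norm2Z normr_nat.
  rewrite xE mulmxDr -lerBlDr; apply: le_trans (lerB_norm2 _ _).
  by rewrite lerD2l lerN2 boundP.
have := Hn z; rewrite mulrBr /K; lra.
Qed.

Lemma measurable_dominated p q n (X : T -> 'M[R]_(p, n)) (Y : T -> 'M[R]_(q, n)) :
  measurable_mx X -> measurable_mx Y ->
  measurable [set w | forall x : 'cV_n, dot (X w *m x) (X w *m x) <= dot (Y w *m x) (Y w *m x)].
Proof.
move=> mX mY; rewrite (_ : [set w | _] = [set w | forall x : 'cV[int]_n,
  dot (X w *m map_mx intr x) (X w *m map_mx intr x) <=
  dot (Y w *m map_mx intr x) (Y w *m map_mx intr x)]); last first.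
  by apply/seteqP; split => w /= H; [move=> x; exact: H|exact: int_dominated].
apply: measurable_forall => x; apply: measurable_set_le; apply: measurable_dot;
  by apply: measurable_mxM => //; exact: measurable_mx_cst.
Qed.

End Operations.
End Measurability.

(** * The GLU approximation for fixed sketches *)

Section Glu.
Context {R : realType}.

Lemma norm2_projl m (P : 'M[R]_m) (x : 'cV[R]_m) :
  P^T = P -> P *m P = P -> norm2 (P *m x) <= norm2 x.
Proof.
move=> PT PP; have -> : P = 1%:M - (1%:M - P) by rewrite opprB addrC subrK.
apply: norm2_proj; first by rewrite linearB /= trmx1 PT.
by rewrite mulmxBr mulmx1 mulmxBl mul1mx PP subrr subr0.
Qed.

Lemma moore_penrose_left m n (B : 'M[R]_(m, n)) :
  \rank B = n -> moore_penrose B *m B = 1%:M.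
Proof.
move=> rB; have [BXB _ _ _] := moore_penroseP B.
have fB : row_full B by rewrite /row_full rB.
by apply: (row_full_inj fB); rewrite mulmxA BXB mulmx1.
Qed.

Definition range_proj m l (D : 'M[R]_(m, l)) : 'M[R]_m :=
  D *m invmx (D^T *m D) *m D^T.

Lemma range_projP m l (D : 'M[R]_(m, l)) : D^T *m D \in unitmx ->
  [/\ (range_proj D)^T = range_proj D,
      range_proj D *m range_proj D = range_proj D & range_proj D *m D = D].
Proof.
move=> uD; have PD : range_proj D *m D = D by rewrite /range_proj -mulmxA mulmxKV.
split=> //.
  by rewrite /range_proj !trmx_mul trmxK trmx_inv trmx_mul trmxK mulmxA.
by rewrite {2}/range_proj !mulmxA PD.
Qed.

Section Deterministic.
Variables (m n l' l : nat) (A : 'M[R]_(m, n)) (U : 'M[R]_(l', m)) (V : 'M[R]_(n, l)).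
Let D := A *m V.
Let B := U *m A *m V.
Let BE : B = U *m D. Proof. by rewrite /B /D mulmxA. Qed.
Hypothesis rB : \rank B = l.

(* The oblique projection of the sketched least squares problem. *)
Definition sketch_proj : 'M[R]_m := D *m moore_penrose B *m U.

Lemma glu_mulr (u : 'cV[R]_l) : glu A U V *m (V *m u) = A *m (V *m u).
Proof.
have BB : moore_penrose B *m B = 1%:M by exact: moore_penrose_left.
rewrite !mulmxA; congr (_ *m u).
rewrite /glu -/B -mulmxA -/B mulmxDl -(mulmxA (moore_penrose U)) mulmxBl mul1mx.
by rewrite -(mulmxA B) -mulmxA BB !mulmx1 subrr mulmx0 add0r.
Qed.

Lemma glu_residual : A - glu A U V =
  (1%:M - moore_penrose U *m U) *m ((1%:M - sketch_proj) *m A).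
Proof.
rewrite /glu -/B /sketch_proj -/D; set X := moore_penrose B; set Y := moore_penrose U.
have -> : (1%:M - D *m X *m U) *m A = A - D *m X *m (U *m A).
  by rewrite mulmxBl mul1mx !mulmxA.
rewrite [in RHS]mulmxBl mul1mx [in RHS]mulmxBr.
have -> : Y *m U *m A = Y *m (U *m A) by rewrite mulmxA.
have -> : Y *m U *m (D *m X *m (U *m A)) = Y *m (B *m X) *m (U *m A).
  by rewrite BE !mulmxA.
rewrite mulmxDl mulmxBr mulmx1 mulmxBl opprD.
by rewrite (addrC (- (_ - _))) addrA.
Qed.

Lemma sketch_projD : (1%:M - sketch_proj) *m D = 0.
Proof.
have SD : sketch_proj *m D = D *m (moore_penrose B *m B) by rewrite BE /sketch_proj !mulmxA.
by rewrite mulmxBl mul1mx SD moore_penrose_left // mulmx1 subrr.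
Qed.

Lemma penrose_proj p q (X : 'M[R]_(p, q)) :
  (X *m moore_penrose X)^T = X *m moore_penrose X /\
  (X *m moore_penrose X) *m (X *m moore_penrose X) = X *m moore_penrose X /\
  (moore_penrose X *m X)^T = moore_penrose X *m X /\
  (moore_penrose X *m X) *m (moore_penrose X *m X) = moore_penrose X *m X.
Proof.
have [h1 h2 h3 h4] := moore_penroseP X; split => //; split; first by rewrite mulmxA h1.
by split => //; rewrite mulmxA h2.
Qed.

Hypothesis lowU : forall x : 'cV_l, 1 / 4 * norm2 (D *m x) <= norm2 (U *m (D *m x)).

(** [U] maps [Theta y] to the orthogonal projection of [U y] on the range of [B]; the lower bound of
    [U] on the range of [D] then gives [|Theta y| <= 4 |U y|], with no estimate of [B^+] itself. *)
Lemma sketch_proj_norm (mu : R) : 0 <= mu ->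
  (forall y, norm2 (U *m y) <= mu * norm2 y) ->
  forall y : 'cV_m, norm2 ((1%:M - sketch_proj) *m y) <= (1 + 4 * mu) * norm2 y.
Proof.
move=> mu0 Umu y; rewrite mulmxBl mul1mx mulrDl mul1r.
apply: (le_trans (ler_norm2B _ _)); rewrite lerD2l.
set w := moore_penrose B *m (U *m y).
have -> : sketch_proj *m y = D *m w by rewrite /sketch_proj /w !mulmxA.
have UDw : U *m (D *m w) = B *m moore_penrose B *m (U *m y) by rewrite BE /w !mulmxA.
have [s [i _]] := penrose_proj B.
have := norm2_projl (U *m y) s i; have := Umu y; have := lowU w; rewrite UDw; lra.
Qed.

Let Pi := range_proj D.

(** [Theta] fixes the range of [D], so [(1 - Theta) A = F - Theta F], an orthogonal sum. For a
    column [f] of [F], [Theta f = D w] solves a least squares problem, whence [|U D w|^2 = <U D w, U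
    f> = <D w, Pi U^T U f>]; with [lowU] this gives [|D w| <= 16 |Pi U^T U f|], and 256 is the
    square. *)
Lemma glu_fro2 (eta : R) : D^T *m D \in unitmx -> 0 <= eta ->
  fro2 (Pi *m U^T *m U *m (A - Pi *m A)) <= eta * fro2 (A - Pi *m A) ->
  fro2 (A - glu A U V) <= (1 + 256 * eta) * fro2 (A - Pi *m A).
Proof.
move=> uD eta0; have [] := range_projP uD; rewrite -/Pi => PT PP PD; set F := A - Pi *m A => HF.
have DP : D^T *m Pi = D^T by have := congr1 trmx PD; rewrite (trmx_mul Pi) PT.
have DF : D^T *m F = 0.
  by rewrite /F mulmxBr mulmxA DP subrr.
rewrite glu_residual.
have [_ [_ [s i]]] := penrose_proj U.
apply: (le_trans (fro2_proj _ s i)).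
have -> : (1%:M - sketch_proj) *m A = F - sketch_proj *m F.
  have -> : F - sketch_proj *m F = (1%:M - sketch_proj) *m F by rewrite mulmxBl mul1mx.
  rewrite /F mulmxBr [X in _ = _ - X](_ : _ = 0) ?subr0 //.
  transitivity ((1%:M - sketch_proj) *m D *m (invmx (D^T *m D) *m D^T *m A)).
    by rewrite /Pi /range_proj !mulmxA.
  by rewrite sketch_projD mul0mx.
rewrite fro2D; last first.
  have FD : F^T *m D = 0 by rewrite -[D]trmxK -trmx_mul DF trmx0.
  have -> : F^T *m - (sketch_proj *m F) = - (F^T *m D *m (moore_penrose B *m U *m F)).
    by rewrite mulmxN /sketch_proj !mulmxA.
  by rewrite FD mul0mx oppr0.
rewrite fro2N mulrDl mul1r lerD2l.
suff : fro2 (sketch_proj *m F) <= 256 * fro2 (Pi *m U^T *m U *m F) by lra.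
apply: fro2_le => j; rewrite !col_mul; set f := col j F.
suff : norm2 (sketch_proj *m f) <= 16 * norm2 (Pi *m U^T *m U *m f).
  by rewrite ler_norm2 // (_ : 16 ^+ 2 = 256) //; ring.
set w := moore_penrose B *m (U *m f).
have -> : sketch_proj *m f = D *m w by rewrite /sketch_proj /w !mulmxA.
have [Bs [Bi _]] := penrose_proj B.
have e1 : dot (U *m (D *m w)) (U *m (D *m w)) = dot (D *m w) (Pi *m U^T *m U *m f).
  have UDw : U *m (D *m w) = B *m moore_penrose B *m (U *m f) by rewrite BE /w !mulmxA.
  have -> : dot (U *m (D *m w)) (U *m (D *m w)) = dot (U *m (D *m w)) (U *m f).
    by rewrite {2}UDw dot_mulr Bs UDw mulmxA Bi.
  have -> : Pi *m U^T *m U *m f = Pi *m (U^T *m (U *m f)) by rewrite !mulmxA.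
  by rewrite [RHS]dot_mulr PT (mulmxA Pi D) PD [LHS]dot_mull.
have := lowU w; have := ler_dot (D *m w) (Pi *m U^T *m U *m f).
rewrite -e1 -sqr_norm2; have := norm2_ge0 (D *m w); set a := norm2 (D *m w).
set b := norm2 (U *m (D *m w)); set c := norm2 (_ *m f) => a0 bc ab.
have [a00|an0] := eqVneq a 0; first by rewrite a00 mulr_ge0 ?norm2_ge0.
have ap : 0 < a by rewrite lt_neqAle eq_sym an0.
have : (1 / 4 * a) ^+ 2 <= a * c.
  by apply: le_trans bc; rewrite ler_sqr ?nnegrE ?mulr_ge0 ?norm2_ge0.
rewrite exprMn expr2 (_ : _ * a ^+ 2 = a * (1 / 16 * a)); last by field.
rewrite ler_pM2l //; lra.
Qed.

End Deterministic.
End Glu.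

(** * The right sketch and the leading right singular vectors *)

Section GluRight.
Context {R : realType}.

Lemma low_gram_unit r k (M : 'M[R]_(r, k)) :
  (forall x : 'cV_k, 1 / 4 * norm2 x <= norm2 (M *m x)) -> M^T *m M \in unitmx.
Proof.
move=> lowM; apply: gram_unitmx => x Mx; apply/eqP; rewrite -norm2_eq0 eq_le norm2_ge0 andbT.
by have := lowM x; rewrite Mx norm2_0; lra.
Qed.

(** For [w = (M^T M)^-1 b] one has [|M w|^2 = <w, b>] and [|w| <= 4 |M w|]; the two inequalities
    bootstrap. *)
Lemma low_gram_inv r k (M : 'M[R]_(r, k)) (b : 'cV[R]_k) :
  (forall x : 'cV_k, 1 / 4 * norm2 x <= norm2 (M *m x)) ->
  norm2 (M *m (invmx (M^T *m M) *m b)) <= 4 * norm2 b /\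
  norm2 (invmx (M^T *m M) *m b) <= 16 * norm2 b.
Proof.
move=> lowM; have uM := low_gram_unit lowM.
set w := invmx (M^T *m M) *m b.
have e : norm2 (M *m w) ^+ 2 <= norm2 w * norm2 b.
  rewrite sqr_norm2 dot_mull mulmxA (_ : M^T *m M *m w = b) ?ler_dot //.
  by rewrite /w mulmxA mulmxV // mul1mx.
have := lowM w; have := norm2_ge0 (M *m w); have := norm2_ge0 w; have := norm2_ge0 b.
move: e; set x := norm2 (M *m w); set y := norm2 w; set z := norm2 b => e z0 y0 x0 yx.
have h : x <= 4 * z.
  have [x00|xn0] := eqVneq x 0; first by rewrite x00 mulr_ge0.
  have xp : 0 < x by rewrite lt_neqAle eq_sym xn0.
  rewrite -(ler_pM2l xp) -expr2 (le_trans e) // mulrA ler_wpM2r //; lra.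
by split => //; lra.
Qed.

Variables (m n l k : nat) (A : 'M[R]_(m, n)) (U0 : 'M[R]_m) (s : seq R) (W : 'M[R]_n).
Hypothesis svdA : is_svd A U0 s W.
Hypothesis kn : (k <= n)%N.
Variable V : 'M[R]_(n, l).
Let Vk : 'M[R]_(n, k) := top_cols k W.
Hypothesis lowV : forall x : 'cV_k, 1 / 4 * norm2 x <= norm2 (V^T *m (Vk *m x)).

Let oVk : orthonormal_cols Vk. Proof. exact: (svd_first_orthonormal svdA kn). Qed.

Let M : 'M[R]_(l, k) := V^T *m Vk.

Let lowM (x : 'cV_k) : 1 / 4 * norm2 x <= norm2 (M *m x).
Proof. by rewrite /M -mulmxA. Qed.

Let MT : Vk^T *m V = M^T. Proof. by rewrite (trmx_mul V^T) trmxK. Qed.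

(** [M (M^T M)^-1] is the pseudo-inverse of [Vk^T V], so [V *m right_coef] is an oblique projection
    into the range of [V] along the orthogonal complement of the leading right singular vectors. *)
Definition right_coef : 'M[R]_(l, n) := M *m invmx (M^T *m M) *m Vk^T.

Lemma right_coefP : Vk^T *m (1%:M - V *m right_coef) = 0.
Proof.
have e : M^T *m right_coef = M^T *m M *m invmx (M^T *m M) *m Vk^T.
  by rewrite /right_coef !mulmxA.
by rewrite mulmxBr mulmx1 mulmxA MT e mulmxV ?(low_gram_unit lowM) // mul1mx subrr.
Qed.

Lemma right_coef_norm (nu : R) : 0 <= nu ->
  (forall y : 'cV_n, norm2 (V^T *m y) <= nu * norm2 y) ->
  forall x : 'cV_n, norm2 ((1%:M - V *m right_coef) *m x) <= (1 + 4 * nu) * norm2 x.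
Proof.
move=> nu0 Vnu x; rewrite mulmxBl mul1mx mulrDl mul1r.
apply: (le_trans (ler_norm2B _ _)); rewrite lerD2l.
have -> : V *m right_coef *m x = V *m (M *m (invmx (M^T *m M) *m (Vk^T *m x))).
  by rewrite /right_coef !mulmxA.
have := norm2_dual nu0 Vnu (M *m (invmx (M^T *m M) *m (Vk^T *m x))); rewrite trmxK.
move/le_trans; apply; rewrite (mulrC 4) -mulrA ler_wpM2l //.
have [h _] := low_gram_inv (Vk^T *m x) lowM; apply: (le_trans h).
by rewrite ler_wpM2l // norm2_orthonormalT.
Qed.

(** The test space is the range of [V N] with [N = V^T Vj], on which the approximation coincides
    with [A]. For [y = V N w], [|A y| >= s_j |Vj^T y|], and [Vj^T y = N^T N w] has norm at least
    [|N w| / 4], hence at least [|y| / (4 nu)]. *)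
Lemma glu_sigma_ge l' (U : 'M[R]_(l', m)) (nu : R) j :
  \rank (U *m A *m V) = l -> 0 < nu ->
  (forall y : 'cV_n, norm2 (V^T *m y) <= nu * norm2 y) -> (0 < j <= k)%N ->
  s`_j.-1 / (4 * nu) <= sigma (glu A U V) j.
Proof.
move=> rB nu0 Vnu /andP[j0 jk].
have jn : (j <= n)%N by exact: leq_trans kn.
pose Vj : 'M[R]_(n, j) := top_cols j W.
have oVj : orthonormal_cols Vj by exact: (svd_first_orthonormal svdA jn).
pose N := V^T *m Vj.
have lowN (w : 'cV_j) : 1 / 4 * norm2 w <= norm2 (N *m w).
  have VjE : Vj = Vk *m (pid_mx j : 'M[R]_(k, j)).
    by rewrite /Vj /Vk /top_cols -mulmxA mul_pid_mx minnA minnn (minn_idPr jk).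
  have e : norm2 w = norm2 ((pid_mx j : 'M[R]_(k, j)) *m w).
    by rewrite -(norm2_orthonormal w oVj) VjE -mulmxA norm2_orthonormal.
  have -> : N *m w = V^T *m (Vk *m ((pid_mx j : 'M[R]_(k, j)) *m w)).
    by rewrite /N VjE !mulmxA.
  by rewrite e; exact: lowV.
have key (w : 'cV_j) : norm2 (N *m w) <= 4 * norm2 (Vj^T *m (V *m (N *m w))).
  have [->|Nw0] := eqVneq (N *m w) 0.
    by rewrite norm2_0 mulr_ge0 ?norm2_ge0.
  have Np : 0 < norm2 (N *m w) by rewrite norm2_gt0.
  have := ler_dot w (Vj^T *m (V *m (N *m w))).
  have -> : dot w (Vj^T *m (V *m (N *m w))) = norm2 (N *m w) ^+ 2.
    by rewrite sqr_norm2 dot_mulr dot_mulr trmxK mulmxA.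
  move=> h; have h2 := lowN w.
  rewrite -(ler_pM2l Np) -expr2; apply: (le_trans h).
  rewrite mulrA ler_wpM2r ?norm2_ge0 //; lra.
have s0 := svd_ge0 svdA j.-1.
apply: (@sigma_ge _ _ _ _ _ (V *m N)) => //.
- by rewrite divr_ge0 // mulr_ge0 // ltW.
- move=> w wn0; apply/eqP; rewrite -mulmxA => VN0.
  have := key w; rewrite VN0 mulmx0 norm2_0 mulr0 => N0.
  have := lowN w; have : 0 < norm2 w by rewrite norm2_gt0.
  lra.
move=> w; rewrite -mulmxA glu_mulr //.
set y := V *m (N *m w).
have y1 : norm2 y <= nu * norm2 (N *m w).
  by have := norm2_dual (ltW nu0) Vnu (N *m w); rewrite trmxK.
have Ay : s`_j.-1 * norm2 (Vj^T *m y) <= norm2 (A *m y).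
  rewrite -ler_sqr ?nnegrE ?mulr_ge0 ?norm2_ge0 // exprMn !sqr_norm2.
  rewrite (svd_dot_first W y jn) (svd_dot svdA) mulr_sumr big_mkcond /=.
  apply: ler_sum => i _; case: ifP => ij; last by rewrite mulr_ge0 ?sqr_ge0.
  apply: ler_wpM2r; first exact: sqr_ge0.
  rewrite ler_sqr ?nnegrE ?(svd_ge0 svdA) // (svd_decr svdA) //.
  by rewrite -ltnS prednK.
apply: le_trans Ay; rewrite -mulrA ler_wpM2l // mulrC ler_pdivrMr ?mulr_gt0 //.
apply: (le_trans y1); rewrite mulrC mulrA ler_pM2r // mulrC; exact: key.
Qed.

(** Since [(1 - Theta) A V = 0], the residual sees [x] only through [Z x], with [Z] the
    complementary oblique projection. The first [k] coordinates of [Z x] in the basis [W] vanish by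
    [right_coefP]; [j - 1] equations kill the next [j - 1], so that [A] stretches [Z x] by at most
    the singular value of index [k + j]. *)
Lemma glu_sigma_le l' (U : 'M[R]_(l', m)) (mu nu : R) j :
  \rank (U *m A *m V) = l -> 0 <= mu -> 0 <= nu ->
  (forall x : 'cV_l, 1 / 4 * norm2 (A *m V *m x) <= norm2 (U *m (A *m V *m x))) ->
  (forall y : 'cV_m, norm2 (U *m y) <= mu * norm2 y) ->
  (forall y : 'cV_n, norm2 (V^T *m y) <= nu * norm2 y) ->
  (0 < j)%N -> (k + j <= n)%N ->
  sigma (A - glu A U V) j <= (1 + 4 * mu) * (1 + 4 * nu) * s`_(k + j).-1.
Proof.
move=> rB mu0 nu0 lowU Umu Vnu j0 kjn.
set Z := 1%:M - V *m right_coef.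
have pf (i : 'I_j.-1) : (k + i < n)%N.
  by have := ltn_ord i; lia.
pose f (i : 'I_j.-1) : 'I_n := Ordinal (pf i).
apply: (@sigma_le _ _ _ _ _ _ (rowsub f (W^T *m Z))).
- by rewrite prednK.
- by apply: leq_trans kjn; rewrite leq_addl.
move=> x Wx; set x' := Z *m x.
have y0 (i : 'I_n) : (i < (k + j).-1)%N -> (W^T *m x') i 0 = 0.
  move=> ikj; have [ik|ki] := ltnP i k.
    have : Vk^T *m x' = 0 by rewrite /x' mulmxA right_coefP mul0mx.
    move=> Vx; have := svd_dot_first W x' kn; rewrite -/Vk Vx dot0r => /esym/eqP.
    rewrite psumr_eq0 => [/allP/(_ i (mem_index_enum _))|a _]; last exact: sqr_ge0.
    by rewrite ik sqrf_eq0 => /eqP.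
  have ij : (i - k < j.-1)%N by lia.
  have := congr1 (fun N : 'cV_j.-1 => N (Ordinal ij) 0) Wx.
  rewrite mul_rowsub_mx -mulmxA -/x' mxE [RHS]mxE => <-.
  by congr (_ _ 0); apply: val_inj => /=; lia.
have SD := sketch_projD rB.
have e : (A - glu A U V) *m x = (1%:M - moore_penrose U *m U) *m
    ((1%:M - sketch_proj A U V) *m (A *m x')).
  rewrite (glu_residual A U V) -!mulmxA; congr (_ *m _).
  have x'E : x' = x - V *m right_coef *m x by rewrite /x' /Z mulmxBl mul1mx.
  move: SD; rewrite x'E; move: (1%:M - sketch_proj A U V) => S SD.
  rewrite (mulmxBr A) mulmxBr.
  have -> : S *m (A *m (V *m right_coef *m x)) = S *m (A *m V) *m (right_coef *m x).
    by rewrite !mulmxA.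
  by rewrite SD mul0mx subr0.
have [_ [_ [us ui]]] := penrose_proj U.
have sk := svd_ge0 svdA (k + j).-1.
have Ax : norm2 (A *m x') <= s`_(k + j).-1 * norm2 x'.
  rewrite ler_norm2 // (svd_dot svdA) (svd_dotV svdA) mulr_sumr.
  apply: ler_sum => i _; have [ij|ji] := ltnP i (k + j).-1.
    by rewrite y0 // expr0n !mulr0.
  apply: ler_wpM2r; first exact: sqr_ge0.
  by rewrite ler_sqr ?nnegrE ?(svd_ge0 svdA) // (svd_decr svdA).
rewrite e; apply: (le_trans (norm2_proj _ us ui)).
apply: (le_trans (sketch_proj_norm lowU mu0 Umu _)).
rewrite -!mulrA ler_wpM2l ?addr_ge0 ?mulr_ge0 //.
apply: (le_trans Ax); rewrite mulrCA ler_wpM2l //.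
exact: right_coef_norm.
Qed.

(** The projection [P] fixes [A V], so [A] may be replaced by [A Z = E Z] with [E = A - Aopt]. As
    [E Vk = 0], the terms of [(E Z)^T = E^T - Vk T] are orthogonal, and [low_gram_inv] bounds [T] by
    the sketched product. *)
Lemma right_fro2 (Aopt : 'M[R]_(m, n)) (eta : R) :
  Aopt = A *m Vk *m Vk^T -> (A *m V)^T *m (A *m V) \in unitmx ->
  fro2 (Vk^T *m V *m V^T *m (A - Aopt)^T) <= eta * fro2 (A - Aopt)^T ->
  fro2 (A - range_proj (A *m V) *m A) <= (1 + 256 * eta) * fro2 (A - Aopt).
Proof.
move=> AoptE uD; set E := A - Aopt => HE.
have [PT PP PD] := range_projP uD; set P := range_proj (A *m V) in PT PP PD *.
set Z := 1%:M - V *m right_coef.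
have EV : E *m Vk = 0.
  by rewrite /E AoptE mulmxBl -[_ *m Vk^T *m Vk]mulmxA oVk mulmx1 subrr.
have AZ : A *m Z = E *m Z.
  have -> : A = E + Aopt by rewrite /E subrK.
  by rewrite mulmxDl addrC {1}AoptE -(mulmxA (A *m Vk)) right_coefP mulmx0 add0r.
have -> : A - P *m A = (1%:M - P) *m (A *m Z).
  have -> : A *m Z = A - A *m V *m right_coef by rewrite /Z mulmxBr mulmx1 !mulmxA.
  rewrite mulmxBr !mulmxBl !mul1mx [P *m (_ *m right_coef)]mulmxA PD.
  by rewrite subrr subr0.
apply: (le_trans (fro2_proj _ PT PP)); rewrite AZ.
set T := invmx (M^T *m M) *m (Vk^T *m V *m V^T *m E^T).
have ZT : (E *m Z)^T = E^T - Vk *m T.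
  have uT : (invmx (M^T *m M))^T = invmx (M^T *m M).
    by rewrite trmx_inv (trmx_mul M^T) trmxK.
  have RT : right_coef^T = Vk *m (invmx (M^T *m M) *m M^T).
    by rewrite /right_coef (trmx_mul _ Vk^T) trmxK (trmx_mul M) uT.
  rewrite (trmx_mul E) /Z linearB /= trmx1 (trmx_mul V) RT mulmxBl mul1mx.
  by rewrite /T MT !mulmxA.
rewrite -fro2_tr ZT fro2D; last first.
  rewrite trmxK mulmxN mulmxA.
  by rewrite EV mul0mx oppr0.
rewrite fro2N fro2_orthonormal // mulrDl mul1r fro2_tr lerD2l.
move: HE; rewrite fro2_tr => HE.
suff : fro2 T <= 256 * fro2 (Vk^T *m V *m V^T *m E^T) by lra.
apply: fro2_le => i; rewrite /T col_mul; set b := col i _.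
have [_ h] := low_gram_inv b lowM.
by move: h; rewrite ler_norm2 // (_ : 16 ^+ 2 = 256) //; ring.
Qed.

End GluRight.

(** * Sketching a random range *)

Section Joint.
Context {R : realType}.

Lemma norm2_dominated p q n (A : 'M[R]_(p, n)) (B : 'M[R]_(q, n)) :
  (forall x : 'cV_n, dot (A *m x) (A *m x) <= dot (B *m x) (B *m x)) <->
  (forall x : 'cV_n, norm2 (A *m x) <= norm2 (B *m x)).
Proof.
have E (x : 'cV_n) : (norm2 (A *m x) <= norm2 (B *m x))
    = (dot (A *m x) (A *m x) <= dot (B *m x) (B *m x)).
  by rewrite -[leRHS]mul1r ler_norm2 // expr1n mul1r.
by split => H x; have := H x; rewrite E.
Qed.

Lemma measurable_lower_bound d (T : measurableType d) p q n
    (X : T -> 'M[R]_(p, n)) (Y : T -> 'M[R]_(q, n)) (c : R) : 0 <= c ->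
  measurable_mx X -> measurable_mx Y ->
  measurable [set w | forall x : 'cV_n, c * norm2 (X w *m x) <= norm2 (Y w *m x)].
Proof.
move=> c0 mX mY.
rewrite (_ : [set w | _] = [set w | forall x : 'cV_n,
    dot ((c *: X w) *m x) ((c *: X w) *m x) <= dot (Y w *m x) (Y w *m x)]).
  apply: measurable_dominated => //.
  by apply: measurable_mxZ => //; exact: measurable_cst.
apply/seteqP; split => w /= H.
  apply/norm2_dominated => x; rewrite -scalemxAl norm2Z ger0_norm //.
move=> x; have /norm2_dominated/(_ x) := H.
by rewrite -scalemxAl norm2Z ger0_norm.
Qed.

Lemma independent_tr d d1 (Omega : measurableType d) (T1 : measurableType d1)
    (P : probability Omega R) n l (X : Omega -> T1) (Y : Omega -> 'M[R]_(n, l)) :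
  independent P X Y -> independent P X (fun w => (Y w)^T).
Proof.
move=> ind B C mB mC.
have mT : measurable_fun setT (fun M : 'M[R]_(n, l) => M^T).
  by apply/measurable_mxP; apply: measurable_mx_tr; apply/measurable_mxP.
have := ind B ((fun M : 'M[R]_(n, l) => M^T) @^-1` C) mB; apply.
by rewrite -[X in measurable X]setTI; exact: mT.
Qed.

Section WithDistributions.
Variables (d : measure_display) (Omega : measurableType d) (P : probability Omega R).
Variables (m n l' l : nat) (A : 'M[R]_(m, n)).
Variables (mu : probability 'M[R]_(l', m) R) (nu : probability 'M[R]_(l, n) R).
Variables (U1 : Omega -> 'M[R]_(l', m)) (V1 : Omega -> 'M[R]_(n, l)).
Hypotheses (lawU : drawn_from P U1 mu) (lawV : drawn_from P (fun w => (V1 w)^T) nu).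
Hypothesis ind : independent P U1 V1.

Let mU : measurable_mx (fun z : 'M[R]_(l, n) * 'M[R]_(l', m) => z.2).
Proof. by apply/measurable_mxP; exact: measurable_snd. Qed.

Let mD : measurable_mx (fun z : 'M[R]_(l, n) * 'M[R]_(l', m) => A *m z.1^T).
Proof.
apply: measurable_mxM; first exact: measurable_mx_cst.
by apply: measurable_mx_tr; apply/measurable_mxP; exact: measurable_fst.
Qed.

Lemma joint_event (p : R) (J : 'M[R]_(m, l) -> 'M[R]_(l', m) -> Prop) :
  measurable [set z : 'M[R]_(l, n) * 'M[R]_(l', m) | J (A *m z.1^T) z.2] ->
  (forall D, with_prob_ge mu p [set S | J D S]) ->
  with_prob_ge P p [set w | J (A *m V1 w) (U1 w)].
Proof.
move=> mJ Jp.
have := with_prob_ge_joint lawU lawV (independent_tr ind) mJ (fun y => Jp (A *m y^T)).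
by apply: with_prob_ge_sub => w /=; rewrite trmxK.
Qed.

Let lower (D : 'M[R]_(m, l)) (S : 'M[R]_(l', m)) :=
  forall x : 'cV_l, 1 / 4 * norm2 (D *m x) <= norm2 (S *m D *m x).

Let measurable_lower :
  measurable [set z : 'M[R]_(l, n) * 'M[R]_(l', m) | lower (A *m z.1^T) z.2].
Proof. by apply: measurable_lower_bound => //; exact: measurable_mxM. Qed.

Let lowerP D S (Q : 'M[R]_(m, l)) (T : 'M[R]_l) : orthonormal_cols Q -> D = Q *m T ->
  (forall x : 'cV_l, 1 / 4 * norm2 x <= norm2 (S *m (Q *m x))) -> lower D S.
Proof.
move=> oQ -> H x; rewrite -!mulmxA norm2_orthonormal //.
Qed.

Lemma joint_norm (p C : R) : 0 <= C -> (l <= m)%N ->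
  (forall Q : 'M[R]_(m, l), orthonormal_cols Q -> with_prob_ge mu p [set S |
     (forall x : 'cV_l, 1 / 4 * norm2 x <= norm2 (S *m (Q *m x))) /\
     (forall y : 'cV_m, norm2 (S *m y) <= C * norm2 y)]) ->
  with_prob_ge P p [set w | lower (A *m V1 w) (U1 w) /\
     (forall y : 'cV_m, norm2 (U1 w *m y) <= C * norm2 y)].
Proof.
move=> C0 lm H.
apply: (joint_event (J := fun D S => lower D S /\ forall y : 'cV_m, norm2 (S *m y) <= C * norm2 y)).
  apply: measurableI => //.
  (* The upper bound becomes a domination by the constant matrix [C%:M], hence a countable
     condition. *)
  rewrite [X in measurable X](_ : _ = [set z : 'M[R]_(l, n) * 'M[R]_(l', m) | forall x : 'cV_m,
     1 * norm2 (z.2 *m x) <= norm2 (C%:M *m x)]).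
    apply: measurable_lower_bound => //; exact: measurable_mx_cst.
  apply/seteqP; split => z /= h x; have := h x;
    by rewrite mul1r mul_scalar_mx norm2Z ger0_norm.
move=> D; have [Q [T [oQ DE]]] := orthonormal_range D lm.
apply: with_prob_ge_sub (H Q oQ) => S /= [lo hi]; split => //.
exact: lowerP oQ DE lo.
Qed.

Lemma joint_mult (p eta : R) : (l <= m)%N ->
  (forall Q : 'M[R]_(m, l), forall G : 'M[R]_(m, n), orthonormal_cols Q ->
     Q^T *m G = 0 -> with_prob_ge mu p [set S |
     (forall x : 'cV_l, 1 / 4 * norm2 x <= norm2 (S *m (Q *m x))) /\
     fro2 (Q^T *m S^T *m S *m G) <= eta * fro2 G]) ->
  with_prob_ge P p [set w | lower (A *m V1 w) (U1 w) /\
     let D := A *m V1 w in D^T *m D \in unitmx ->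
     fro2 (range_proj D *m (U1 w)^T *m U1 w *m (A - range_proj D *m A)) <=
     eta * fro2 (A - range_proj D *m A)].
Proof.
move=> lm H.
pose J2 (D : 'M[R]_(m, l)) (S : 'M[R]_(l', m)) := D^T *m D \in unitmx ->
  fro2 (range_proj D *m S^T *m S *m (A - range_proj D *m A)) <=
     eta * fro2 (A - range_proj D *m A).
apply: (joint_event (J := fun D S => lower D S /\ J2 D S)).
  apply: measurableI => //.
  pose dt (D : 'M[R]_(m, l)) := \det (D^T *m D).
  pose Pt (D : 'M[R]_(m, l)) := D *m \adj (D^T *m D) *m D^T.
  pose F (D : 'M[R]_(m, l)) := dt D *: A - Pt D *m A.
  (* Multiplying by powers of the Gram determinant makes the condition polynomial. *)
  rewrite [X in measurable X](_ : _ = [set z : 'M[R]_(l, n) * 'M[R]_(l', m) |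
     let D := A *m z.1^T in
     fro2 (dt D *: (Pt D *m z.2^T *m z.2 *m F D)) <= eta * dt D ^+ 4 * fro2 (F D)]).
    have mDD : measurable_mx (fun z : 'M[R]_(l, n) * 'M[R]_(l', m) =>
        (A *m z.1^T)^T *m (A *m z.1^T)).
      by apply: measurable_mxM => //; exact: measurable_mx_tr.
    have mdt := measurable_det mDD.
    have mPt : measurable_mx (fun z : 'M[R]_(l, n) * 'M[R]_(l', m) => Pt (A *m z.1^T)).
      apply: measurable_mxM; last exact: measurable_mx_tr.
      by apply: measurable_mxM => //; exact: measurable_adj.
    have mF : measurable_mx (fun z : 'M[R]_(l, n) * 'M[R]_(l', m) => F (A *m z.1^T)).
      apply: measurable_mxB.
        by apply: measurable_mxZ => //; exact: measurable_mx_cst.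
      by apply: measurable_mxM => //; exact: measurable_mx_cst.
    apply: measurable_set_le.
      apply: measurable_fro2; apply: measurable_mxZ => //.
      apply: measurable_mxM => //; apply: measurable_mxM => //.
      by apply: measurable_mxM => //; exact: measurable_mx_tr.
    apply: measurable_funM; last exact: measurable_fro2.
    apply: measurable_funM; first exact: measurable_cst.
    exact: measurable_funX.
  suff E D (S : 'M[R]_(l', m)) : J2 D S <->
      fro2 (dt D *: (Pt D *m S^T *m S *m F D)) <= eta * dt D ^+ 4 * fro2 (F D).
    by apply/seteqP; split => z /= /E.
  rewrite /J2 unitmxE unitfE -/(dt D).
  (* At a vanishing determinant [J2] is vacuous and both sides of the polynomial inequality are 0;
     elsewhere they are those of [J2] times [dt D ^+ 6]. *)
  have [d0|dn0] := eqVneq (dt D) 0.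
    by rewrite d0 scale0r fro20 expr0n mulr0 mul0r lexx; split.
  have PtE : Pt D = dt D *: range_proj D.
    rewrite /Pt /range_proj /invmx unitmxE unitfE -/(dt D) dn0.
    by rewrite -scalemxAr -scalemxAl scalerA mulfV // scale1r.
  have FE : F D = dt D *: (A - range_proj D *m A).
    by rewrite /F PtE -scalemxAl scalerBr.
  rewrite FE PtE -!scalemxAl -!scalemxAr !scalerA !fro2Z.
  set x := fro2 _; set y := fro2 _.
  have d6 : 0 < dt D ^+ 6 by rewrite exprn_even_gt0 ?dn0.
  have -> : (dt D * dt D * dt D) ^+ 2 * x = dt D ^+ 6 * x by ring.
  have -> : eta * dt D ^+ 4 * (dt D ^+ 2 * y) = dt D ^+ 6 * (eta * y) by ring.
  by rewrite ler_pM2l //; split => [h|h _]; [exact: h|].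
move=> D; have [Q [T [oQ DE]]] := orthonormal_range D lm.
have QG : Q^T *m (A - Q *m Q^T *m A) = 0.
  by rewrite mulmxBr !mulmxA oQ mul1mx subrr.
apply: with_prob_ge_sub (H Q _ oQ QG) => S /= [lo hi]; split.
  exact: lowerP oQ DE lo.
move=> uD.
have DD : D^T *m D = T^T *m T by rewrite DE trmx_mul mulmxA -(mulmxA T^T) oQ mulmx1.
(* [T] is square, so its left inverse is also a right inverse: once the Gram matrix is invertible,
   [D] and [Q] have the same range. *)
have TT : T *m invmx (T^T *m T) *m T^T = 1%:M.
  by apply: mulmx1C; rewrite mulmxA mulmxV // -DD.
have -> : range_proj D = Q *m Q^T.
  transitivity (Q *m (T *m invmx (T^T *m T) *m T^T) *m Q^T); last by rewrite TT mulmx1.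
  by rewrite /range_proj DD DE trmx_mul !mulmxA.
rewrite -2!(mulmxA Q) -!(mulmxA Q) fro2_orthonormal //.
by rewrite !mulmxA in hi *.
Qed.

End WithDistributions.
End Joint.

(** * Truncated decompositions and assembly of the three bounds *)

Section Parts.
Context {R : realType}.

Lemma truncated_svd_proj k m n (A : 'M[R]_(m, n)) U s V : is_svd A U s V ->
  U *m rect_diag m n (take k s) *m V^T = A *m top_cols k V *m (top_cols k V)^T.
Proof.
case=> -[oU oV] _ _ _ ->.
rewrite /top_cols trmx_mul tr_pid_mx !mulmxA -(mulmxA _ V^T V) oV mulmx1.
rewrite -(mulmxA _ (pid_mx k) (pid_mx k)) mul_pid_mx; congr (_ *m _).
rewrite -mulmxA; congr (_ *m _); apply/matrixP => i j; rewrite !mxE.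
rewrite (bigD1 j) //= big1 ?addr0 => [|a aj]; last first.
  by rewrite [X in _ * X]mxE (_ : (a == j :> nat) = false) ?mulr0 //; exact: negbTE.
rewrite !mxE eqxx /=; case: eqP => [ij|_]; last by rewrite mul0r.
rewrite !minnn -ij; have [ik|ki] := ltnP i k; first by rewrite nth_take // mulr1.
by rewrite mulr0 nth_default // size_take_min geq_min ki.
Qed.

End Parts.

Theorem theorem5p7 (R : realType) :
  exists c C : R, [/\ 0 < c, 0 < C &
  forall (m n k l l' : nat) (A : 'M[R]_(m, n)) (eps delta : R)
    (mu : probability 'M[R]_(l', m) R) (nu : probability 'M[R]_(l, n) R)
    (d : measure_display) (Omega : measurableType d) (P : probability Omega R)
    (U1 : Omega -> 'M[R]_(l', m)) (V1 : Omega -> 'M[R]_(n, l)),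
  (1 <= k)%N -> (k <= l)%N -> (l <= l')%N -> (l <= n)%N -> (l' <= m)%N ->
  0 < eps < 1 / 6 ->
  2 * expR (- (k%:R / 5)) < delta ->
  OSE l eps delta mu -> OSE k eps delta nu ->
  drawn_from P U1 mu -> drawn_from P (fun w => (V1 w)^T) nu ->
  independent P U1 V1 ->
  {ae P, forall w, [/\ \rank (U1 w) = l', \rank (V1 w) = l
                     & \rank (U1 w *m A *m V1 w) = l]} ->
  [/\ with_prob_ge P (1 - 2 * delta)
        [set w | forall j, (1 <= j <= k)%N ->
           sigma (glu A (U1 w) (V1 w)) j
             >= c * Num.sqrt (k%:R / n%:R) * sigma A j],
      forall j, (1 <= j <= minn m n - k)%N ->
        with_prob_ge P (1 - 4 * delta)
          [set w | sigma (A - glu A (U1 w) (V1 w)) j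
             <= C * Num.sqrt ((m%:R * n%:R) / (k%:R * l%:R)) * sigma A (k + j)]
    & JLT (Num.sqrt (eps / l%:R)) delta m mu ->
      JLT (Num.sqrt (eps / k%:R)) delta n nu ->
      forall Aopt : 'M[R]_(m, n), is_truncated_svd k A Aopt ->
        with_prob_ge P (1 - 4 * delta)
          [set w | normF (A - glu A (U1 w) (V1 w)) ^+ 2
             <= (1 + C * eps) * normF (A - Aopt) ^+ 2]]].
Proof.
have [Cn Cn0 norm_event] := @sketch_norm R.
have [Cm Cm0 mult_event] := @sketch_mult R.
(* Each sketch costs a factor [1 + a eps] in the Frobenius bound, and [eps < 1] turns their product
   into at most [1 + C2 eps]; [C1] serves the singular values of the residual. *)
pose a := 256 * Cm; have a0 : 0 <= a by rewrite /a; lra.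
pose C1 := (1 + 4 * Cn) ^+ 2; pose C2 := 2 * a + a ^+ 2.
have C10 : 0 < C1 by rewrite exprn_gt0 //; lra.
have C20 : 0 <= C2 by apply: addr_ge0; [exact: mulr_ge0|exact: sqr_ge0].
exists (1 / (4 * Cn)), (C1 + C2); split; first by rewrite divr_gt0 // mulr_gt0.
  by rewrite ltr_wpDr.
move=> m n k l l' A eps delta mu nu d Omega P U1 V1 k1 kl ll' ln l'm e6 _.
move=> oseU oseV lawU lawV ind ranks.
have kn : (k <= n)%N := leq_trans kl ln.
have lm : (l <= m)%N := leq_trans ll' l'm.
have l1 : (0 < l)%N := leq_trans k1 kl.
have /andP[e0 _] := e6.
have kr : (0 : R) < k%:R by rewrite ltr0n.
have lr : (0 : R) < l%:R by rewrite ltr0n.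
have nr : (0 : R) < n%:R by rewrite ltr0n (leq_trans k1).
have mr : (0 : R) < m%:R by rewrite ltr0n (leq_trans l1).
have four : 4 * delta = 2 * delta + 2 * delta by ring.
have [U0 [W svdA]] := singular_valuesP A.
have goodV : with_prob_ge P (1 - 2 * delta) [set w |
    (forall x : 'cV_k, 1 / 4 * norm2 x <= norm2 ((V1 w)^T *m (top_cols k W *m x))) /\
    (forall y : 'cV_n, norm2 ((V1 w)^T *m y) <= Cn * Num.sqrt (n%:R / k%:R) * norm2 y)].
  have k1n : (0 < k <= n)%N by rewrite k1.
  exact: with_prob_ge_preimage lawV (norm_event _ _ _ _ _ _ _ k1n e6 oseV (svd_first_orthonormal svdA kn)).
have l1m : (0 < l <= m)%N by rewrite l1.
have nk0 : 0 < Cn * Num.sqrt (n%:R / k%:R) by rewrite mulr_gt0 // sqrtr_gt0 divr_gt0.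
have ml0 : 0 < Cn * Num.sqrt (m%:R / l%:R) by rewrite mulr_gt0 // sqrtr_gt0 divr_gt0.
split.
- apply: with_prob_ge_sub (with_prob_ge_ae goodV ranks) => w /= [[lo hi] [_ _ rB]] j jk.
  have := glu_sigma_ge svdA kn lo rB nk0 hi jk.
  rewrite [sigma A j]/sigma; apply: le_trans.
  have -> : Num.sqrt (k%:R / n%:R) = (Num.sqrt (n%:R / k%:R))^-1 :> R.
    by rewrite -sqrtrV ?divr_ge0 // invf_div.
  by rewrite le_eqVlt; apply/orP; left; apply/eqP; field; rewrite !gt_eqF // sqrtr_gt0 divr_gt0.
- move=> j /andP[j1 jmn].
  have kjn : (k + j <= n)%N by move: j1 jmn; clear; lia.
  have goodU := joint_norm A lawU lawV ind (ltW ml0) lm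
    (fun Q oQ => norm_event _ _ _ _ _ _ Q l1m e6 oseU oQ).
  rewrite four.
  apply: with_prob_ge_sub (with_prob_ge_ae (with_prob_geI goodV goodU) ranks).
  move=> w /= [[[loV hiV] [loU hiU]] [_ _ rB]].
  have loU' (x : 'cV_l) : 1 / 4 * norm2 (A *m V1 w *m x) <= norm2 (U1 w *m (A *m V1 w *m x)).
    by have := loU x; rewrite -(mulmxA (U1 w)).
  apply: (le_trans (glu_sigma_le svdA kn loV rB (ltW ml0) (ltW nk0) loU' hiU hiV j1 kjn)).
  rewrite [sigma A _]/sigma ler_wpM2r ?(svd_ge0 svdA) //.
  (* As [l <= m] and [k <= n], both roots are at least 1, which absorbs the summand 1 of [1 + 4 mu]
     and of [1 + 4 nu]. *)
  have s1 (p q : nat) : (0 < q <= p)%N -> 1 <= Num.sqrt (p%:R / q%:R) :> R.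
    move=> /andP[q0 qp]; rewrite -[leLHS]sqrtr1 ler_wsqrtr // ler_pdivlMr ?ltr0n //.
    by rewrite mul1r ler_nat.
  have hm := s1 _ _ l1m; have hn : 1 <= Num.sqrt (n%:R / k%:R) :> R by apply: s1; rewrite k1.
  have -> : Num.sqrt (m%:R * n%:R / (k%:R * l%:R)) =
      Num.sqrt (m%:R / l%:R) * Num.sqrt (n%:R / k%:R) :> R.
    by rewrite -sqrtrM ?divr_ge0 //; congr Num.sqrt; field; rewrite !gt_eqF.
  set x := Num.sqrt (m%:R / l%:R) in hm *; set y := Num.sqrt (n%:R / k%:R) in hn *.
  apply: (@le_trans _ _ (((1 + 4 * Cn) * x) * ((1 + 4 * Cn) * y))).
    by apply: ler_pM; rewrite ?addr_ge0 ?mulr_ge0 ?(ltW Cn0) ?(le_trans _ hm) ?(le_trans _ hn) //; nra.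
  rewrite mulrACA -expr2 -/C1 ler_wpM2r ?lerDl // mulr_ge0 //; lra.
- move=> _ _ Aopt [U [s [V [svdA' AoptE]]]].
  (* The basis to be tested is read off the decomposition that produced [Aopt], which need not be
     [svdA]; only then is [A - Aopt] orthogonal to it. *)
  have AE := truncated_svd_proj k svdA'; rewrite -AoptE in AE.
  have oV := svd_first_orthonormal svdA' kn.
  have QG : (top_cols k V)^T *m (A - Aopt)^T = 0.
    by rewrite -trmx_mul AE mulmxBl -[_ *m _ *m top_cols k V]mulmxA oV mulmx1 subrr trmx0.
  have k1n : (0 < k <= n)%N by rewrite k1.
  have goodV' := with_prob_ge_preimage lawV
    (mult_event _ _ _ _ _ _ _ _ _ k1n e6 oseV oV QG).
  have goodU := joint_mult A lawU lawV ind lm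
    (fun Q G oQ QG0 => mult_event _ _ _ _ _ _ _ Q G l1m e6 oseU oQ QG0).
  rewrite four.
  apply: with_prob_ge_sub (with_prob_ge_ae (with_prob_geI goodV' goodU) ranks).
  move=> w /= [[[loV hiV] [loU hiU]] [_ _ rB]].
  rewrite !sqr_normF.
  have uD : (A *m V1 w)^T *m (A *m V1 w) \in unitmx.
    apply: gram_unitmx => x Dx.
    have fB : row_full (U1 w *m A *m V1 w) by rewrite /row_full rB.
    by apply: (row_full_inj fB); rewrite -!mulmxA (mulmxA A) Dx !mulmx0.
  have loU' (x : 'cV_l) : 1 / 4 * norm2 (A *m V1 w *m x) <= norm2 (U1 w *m (A *m V1 w *m x)).
    by have := loU x; rewrite -(mulmxA (U1 w)).
  have Ce : 0 <= Cm * eps by rewrite mulr_ge0 // ltW.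
  have h1 := glu_fro2 rB loU' uD Ce (hiU uD).
  rewrite trmxK in hiV.
  have h2 := right_fro2 svdA' kn loV AE uD hiV.
  apply: (le_trans h1); apply: (@le_trans _ _
    ((1 + 256 * (Cm * eps)) * ((1 + 256 * (Cm * eps)) * fro2 (A - Aopt)))).
    by apply: ler_wpM2l h2; lra.
  rewrite mulrA ler_wpM2r ?fro2_ge0 //.
  have -> : 256 * (Cm * eps) = a * eps by rewrite /a mulrA.
  have : a ^+ 2 * eps * eps <= a ^+ 2 * eps * 1.
    apply: ler_wpM2l; last by lra.
    by apply: mulr_ge0; [exact: sqr_ge0|exact: ltW].
  have : 0 <= C1 * eps by rewrite mulr_ge0 // ltW.
  rewrite /C2; lra.
Qed.
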